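(* Let $p$ be a prime number with $p\equiv 3 \pmod 8$, let $R=\mathbb Z_2[X]/(X^2+p)$, and let $n\ge 1$ be an integer. Then the number of isomorphism classes of self-dual skew-Hermitian modules over $R$ of $\mathbb Z_2$-rank $2n$ is $$\sum_{r=0}^n m_r .$$
   Context: Write $R=\mathbb Z_2[X]/(X^2+p)=\mathbb Z_2[\pi]$, where $\pi$ is the image of $X$; it is an order in the $\mathbb Q_2$-algebra $E=\mathbb Q_2[X]/(X^2+p)$. Let $a\mapsto\bar a$ be the non-trivial involution of $E$ over $\mathbb Q_2$ (so $\bar\pi=-\pi$). A skew-Hermitian module over $R$ is a finitely generated $R$-module $M$ that is free over $\mathbb Z_2$, together with a non-degenerate alternating $\mathbb Z_2$-bilinear pairing $\psi:M\times M\to\mathbb Z_2$ such that $\psi(ax,y)=\psi(x,\bar a y)$ for all $a\in R$, $x,y\in M$. It is self-dual if $\psi$ induces an isomorphism $M\to \mathrm{Hom}_{\mathbb Z_2}(M,\mathbb Z_2)$. An isomorphism of skew-Hermitian modules is an $R$-linear isomorphism preserving the pairings. For $r\ge 1$ let $S_r$ be the set of symmetric matrices in $\mathrm{GL}_r(\mathbb F_2)$; for $A,B\in S_r$ write $A\sim B$ if there is $P\in\mathrm{GL}_r(\mathbb F_2)$ with $B=P^tAP$. Put $m_0:=1$ and $m_r:=\#(S_r/\!\sim)$ for $r\ge1$. *)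

(* Defs.v *)
From HB Require Import structures.
From mathcomp Require Import all_boot all_order all_algebra.
From mathcomp Require Import sesquilinear.
From mathcomp Require Import boolp.

Set Implicit Arguments.
Unset Strict Implicit.
Unset Printing Implicit Defensive.

Import GRing.Theory.
Local Open Scope ring_scope.

(* The 2-adic integers, as the inverse limit of the rings Z/2^n: x n is the
   residue of x mod 2^n, represented in [0, 2^n) (the bound follows from
   coherence). *)
Record Z2 := MkZ2 {
  residue :> nat -> nat;
  coherent : forall n, (residue n.+1 %% 2 ^ n = residue n)%N }.

HB.instance Definition _ := gen_eqMixin Z2.
HB.instance Definition _ := gen_choiceMixin Z2.

Lemma Z2P (x y : Z2) : x =1 y -> x = y.
Proof.
case: x y => [f cf] [g cg] /= /funext fg; rewrite -fg in cg *.
by congr MkZ2; exact: Prop_irrelevance.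
Qed.

Lemma residue_mod (x : Z2) n : (x n %% 2 ^ n = x n)%N.
Proof. by rewrite -(coherent x n) modn_mod. Qed.

Lemma residue_modS (x : Z2) n : x n.+1 = x n %[mod 2 ^ n].
Proof. by rewrite coherent residue_mod. Qed.

Lemma modn_expS a n : (a %% 2 ^ n.+1 %% 2 ^ n = a %% 2 ^ n)%N.
Proof. by apply/modn_dvdm/dvdn_exp2l. Qed.

Lemma coherent_add (x y : Z2) n :
  ((x n.+1 + y n.+1) %% 2 ^ n.+1 %% 2 ^ n = (x n + y n) %% 2 ^ n)%N.
Proof. by rewrite modn_expS -modnDm !residue_modS modnDm. Qed.

Lemma coherent_mul (x y : Z2) n :
  ((x n.+1 * y n.+1) %% 2 ^ n.+1 %% 2 ^ n = (x n * y n) %% 2 ^ n)%N.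
Proof. by rewrite modn_expS -modnMm !residue_modS modnMm. Qed.

Lemma residue_le (x : Z2) n : (x n <= 2 ^ n)%N.
Proof. by rewrite -residue_mod ltnW // ltn_mod expn_gt0. Qed.

Lemma coherent_opp (x : Z2) n :
  ((2 ^ n.+1 - x n.+1) %% 2 ^ n.+1 %% 2 ^ n = (2 ^ n - x n) %% 2 ^ n)%N.
Proof.
rewrite modn_expS; apply/eqP; rewrite -(eqn_modDr (x n.+1)).
rewrite subnK ?residue_le // -modnDmr residue_modS modnDmr subnK ?residue_le //.
by rewrite modnn expnS modnMl.
Qed.

Definition Z2nat a := MkZ2 (modn_expS a).
Definition Z2add x y := MkZ2 (coherent_add x y).
Definition Z2mul x y := MkZ2 (coherent_mul x y).
Definition Z2opp x := MkZ2 (coherent_opp x).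

Lemma Z2addA : associative Z2add.
Proof. by move=> x y z; apply: Z2P => n /=; rewrite modnDmr modnDml addnA. Qed.

Lemma Z2addC : commutative Z2add.
Proof. by move=> x y; apply: Z2P => n /=; rewrite addnC. Qed.

Lemma Z2add0 : left_id (Z2nat 0) Z2add.
Proof. by move=> x; apply: Z2P => n /=; rewrite mod0n add0n residue_mod. Qed.

Lemma Z2addN : left_inverse (Z2nat 0) Z2opp Z2add.
Proof.
by move=> x; apply: Z2P => n /=; rewrite modnDml subnK ?residue_le // modnn mod0n.
Qed.

Lemma Z2mulA : associative Z2mul.
Proof. by move=> x y z; apply: Z2P => n /=; rewrite modnMmr modnMml mulnA. Qed.

Lemma Z2mulC : commutative Z2mul.
Proof. by move=> x y; apply: Z2P => n /=; rewrite mulnC. Qed.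

Lemma Z2mul1 : left_id (Z2nat 1) Z2mul.
Proof. by move=> x; apply: Z2P => n /=; rewrite modnMml mul1n residue_mod. Qed.

Lemma Z2mulDl : left_distributive Z2mul Z2add.
Proof.
by move=> x y z; apply: Z2P => n /=; rewrite modnMml modnDm mulnDl.
Qed.

Lemma Z2_1_neq0 : Z2nat 1 != Z2nat 0.
Proof. by apply/eqP => /(congr1 (fun x : Z2 => x 1%N)). Qed.

HB.instance Definition _ := GRing.isZmodule.Build Z2 Z2addA Z2addC Z2add0 Z2addN.
HB.instance Definition _ := GRing.Zmodule_isComNzRing.Build Z2
  Z2mulA Z2mulC Z2mul1 Z2mulDl Z2_1_neq0.

Section Order.
Variable p : nat.

Definition X2p : {poly Z2} := 'X^2 + p%:R%:P.

Lemma size_X2p : size X2p = 3%N.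
Proof. by rewrite size_polyDl size_polyXn // (leq_ltn_trans (size_polyC_leq1 _)). Qed.

Lemma X2p_monic : X2p \is monic.
Proof.
rewrite monicE lead_coefDl ?lead_coefXn //.
by rewrite size_polyXn (leq_ltn_trans (size_polyC_leq1 _)).
Qed.

(* {poly %/ h} is the quotient by h only when h is monic and non-constant. *)
Lemma mk_monic_X2p : mk_monic X2p = X2p.
Proof. by rewrite /mk_monic size_X2p X2p_monic. Qed.

Local Notation ordR := {poly %/ X2p}.

(* The restriction to R of the involution of E = Q_2[X]/(X^2 + p): it sends
   the class of f(X) to that of f(-X). *)
Definition bar (a : ordR) : ordR := in_qpoly X2p ((a : {poly Z2}) \Po (- 'X)).

Lemma qX2 : ('qX : ordR) ^+ 2 = - p%:R.
Proof.
apply/eqP; rewrite -addr_eq0; apply/eqP.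
have <- : in_qpoly X2p X2p = 0.
  by apply: val_inj; rewrite /= mk_monic_X2p Pdiv.RingMonic.rmodpp ?X2p_monic.
have -> : in_qpoly X2p X2p = in_qpoly X2p ('X^2 + p%:R%:P) by [].
by rewrite rmorphD rmorphXn /= polyC_natr rmorph_nat.
Qed.

Lemma bar_qX : bar 'qX = - 'qX.
Proof.
by rewrite /bar qpolyXE ?size_X2p ?X2p_monic // comp_polyX -raddfN.
Qed.

End Order.

Notation ordR p := {poly %/ X2p p}.

Section Restriction.
Variables (A : comNzRingType) (B : algType A) (M : lmodType B).

(* M as an A-module, by restriction of scalars along a |-> a%:A. *)
Definition restr : Type := M.

HB.instance Definition _ := GRing.Zmodule.on restr.

Definition restr_scale (a : A) (x : restr) : restr := (a%:A : B) *: (x : M).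

Lemma restr_scaleA a b x :
  restr_scale a (restr_scale b x) = restr_scale (a * b) x.
Proof. by rewrite /restr_scale scalerA -scalerAl mul1r -scalerA. Qed.

Lemma restr_scale1 : left_id 1 restr_scale.
Proof. by move=> x; rewrite /restr_scale !scale1r. Qed.

Lemma restr_scaleDr : right_distributive restr_scale +%R.
Proof. by move=> a x y; rewrite /restr_scale scalerDr. Qed.

Lemma restr_scaleDl x : {morph restr_scale^~ x : a b / a + b}.
Proof. by move=> a b; rewrite /restr_scale !scalerDl. Qed.

HB.instance Definition _ := GRing.Zmodule_isLmodule.Build A restr
  restr_scaleA restr_scale1 restr_scaleDr restr_scaleDl.

End Restriction.

(* A free module on an arbitrary basis is not covered, but a finitely generated
   R-module that is free over Z_2 has a finite basis. *)
Definition free_of_rank (A : comNzRingType) (V : lmodType A) (k : nat) : Prop :=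
  exists f : V -> 'rV[A]_k, linear f /\ bijective f.

Definition fin_gen (B : nzRingType) (M : lmodType B) : Prop :=
  exists (k : nat) (g : 'I_k -> M),
    forall x, exists c : 'I_k -> B, x = \sum_i c i *: g i.

Notation res2 M := (@restr Z2 _ M).

Record skewHerm (p : nat) := SkewHerm {
  sh_module :> lmodType (ordR p);
  sh_fin_gen : fin_gen sh_module;
  sh_free : exists k, free_of_rank (res2 sh_module) k;
  psi : {biscalar (res2 sh_module)};
  psi_alternating : forall x, psi x x = 0;
  psi_nondegenerate : forall x, (forall y, psi x y = 0) -> x = 0;
  psi_adjoint : forall (a : ordR p) (x y : sh_module),
    psi (a *: x) y = psi x (bar a *: y) }.

Definition has_rank p (M : skewHerm p) (k : nat) : Prop :=
  free_of_rank (res2 M) k.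

Definition self_dual p (M : skewHerm p) : Prop :=
  forall f : {scalar (res2 M)}, exists! x : M, psi M x =1 f.

Definition sh_iso p (M N : skewHerm p) : Prop :=
  exists f : M -> N,
    [/\ linear f, bijective f & forall x y, psi N (f x) (f y) = psi M x y].

(* F picks one representative in each isomorphism class of objects
   satisfying P. *)
Definition num_iso_classes p (P : skewHerm p -> Prop) (N : nat) : Prop :=
  exists F : 'I_N -> skewHerm p,
    [/\ forall i, P (F i),
        forall i j, sh_iso (F i) (F j) -> i = j
      & forall M, P M -> exists i, sh_iso M (F i)].

Definition symGL (r : nat) : {set 'M['F_2]_r} :=
  [set A : 'M['F_2]_r | (A \in unitmx) && (A^T == A)].

Definition congruent (r : nat) : rel 'M['F_2]_r :=
  fun A B => [exists P : 'M['F_2]_r, (P \in unitmx) && (B == P^T *m A *m P)].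

Definition num_sym_classes (r : nat) : nat :=
  if r is 0 then 1%N else #|equivalence_partition (@congruent r) (symGL r)|.

(* Main.v *)
From HB Require Import structures.
Require Import Defs.
From mathcomp Require Import all_boot all_order all_algebra.
From mathcomp Require Import sesquilinear boolp ring zify.

(** Write [h(x, y) = psi(pi x, y) + psi(x, y) pi], a Hermitian form with values in
[R].  The ring [R] is local with residue field F_2, the class of [a + b pi]
being [a + b mod 2], so [h] has a reduction
[psi((1 + pi) x, y) mod 2], a symmetric form on [M / 2M].  Its rank [r] and the
congruence class of the non-degenerate form [A] it induces modulo its radical
are the invariants; they range over the pairs ([r <= n], class in [S_r]), whence
the sum.

The point is that these invariants determine [M], and this rests on the norm
form [a^2 + p b^2] of [R].  For [p = 3 mod 8] it represents every 2-adic unit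
([unit_norm]); moreover [g + 2 c + q (c^2 + p d^2) = 0] has a solution for
all [q] as soon as [g] is even ([norm_equation]).

Choose vectors [e_1, ..., e_r] whose values [h(e_i, e_j)] reduce to [A].  They
span an orthogonal direct summand of [M] that is free over [R].  Their values
can be corrected one at a time so as to become the lift of [A] with entries 0
and 1: adding to [e_k] a multiple of the vector dual to [e_i] changes only
[h(e_k, e_i)] and [h(e_k, e_k)], and the diagonal value is then corrected with
the vector dual to [e_k], through [norm_equation] ([adjust_offdiagonal],
[adjust_diagonal], [exact_lift]).  Here [A] may be any matrix in its class.

On the orthogonal complement [1 + pi] is divisible by 2, so the complement is a
module over the maximal order [Z_2[(1 + pi) / 2]].  There one splits off, again
and again, a vector [v] with [psi(pi v, v) = 2]: such a vector exists because
[psi(pi x, x) / 2] cannot be even everywhere on a self-dual module and because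
every unit is a norm ([unramified_part_extend]).  The vectors [e_i, pi e_i, v_j,
(v_j + pi v_j) / 2] form a basis in which [pi] and [psi] have matrices depending
only on [A] and on [n - r] ([normal_form]).  Conversely these matrices define a
module for every [A] in [S_r] ([std_skew_pair]), and reducing [psi((1 + pi) x, y)]
modulo 2 recovers [r] and the class of [A] ([model_size], [model_congruent]). *)

Set Implicit Arguments.
Unset Strict Implicit.
Unset Printing Implicit Defensive.

Import GRing.Theory.
Local Open Scope ring_scope.

(** * 2-adic arithmetic *)

Lemma residue_nat k n : (k%:R : Z2) n = (k %% 2 ^ n)%N.
Proof.
elim: k => [|k IHk]; first by [].
by rewrite -addn1 natrD /= IHk modnDm.
Qed.

Lemma residue0 (x : Z2) : x 0%N = 0%N.
Proof. by rewrite -residue_mod modn1. Qed.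

Lemma residue_le_mod (x : Z2) n k : (n <= k)%N -> (x k %% 2 ^ n = x n)%N.
Proof.
elim: k => [|k IHk]; first by rewrite leqn0 => /eqP->; rewrite residue_mod.
rewrite leq_eqVlt => /predU1P[->|le_nk]; first by rewrite residue_mod.
by rewrite -IHk // -(coherent x k) modn_dvdm // dvdn_exp2l.
Qed.

(** Multiplication by 2 raises the known precision by one digit, which is what
makes maps of the form [x |-> c + 2 g(x)] contracting. *)
Lemma residue_mul2 (x : Z2) n : (2%:R * x) n.+1 = (2 * x n)%N.
Proof.
rewrite -[LHS]/((2%:R : Z2) n.+1 * x n.+1 %% 2 ^ n.+1)%N.
by rewrite residue_nat modnMml expnS -muln_modr coherent.
Qed.

Lemma mul2_inj : injective (fun x : Z2 => 2%:R * x).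
Proof.
move=> x y exy; apply: Z2P => n; have := congr1 (fun z : Z2 => z n.+1) exy.
by rewrite !residue_mul2 => /eqP; rewrite eqn_mul2l => /eqP.
Qed.

Lemma residueD (x y : Z2) n : (x + y) n = ((x n + y n) %% 2 ^ n)%N.
Proof. by []. Qed.

Lemma residueN (x : Z2) n : (- x) n = ((2 ^ n - x n) %% 2 ^ n)%N.
Proof. by []. Qed.

Lemma residueM (x y : Z2) n : (x * y) n = ((x n * y n) %% 2 ^ n)%N.
Proof. by []. Qed.

(** The iterates of 0 agree to one more digit at each step; the limit is the
coherent sequence whose [n]-th residue is that of the [n]-th iterate. *)
Lemma contraction_fixpoint (f : Z2 -> Z2) :
  (forall n (x y : Z2), x n = y n -> f x n.+1 = f y n.+1) -> exists x, f x = x.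
Proof.
move=> f_contr; pose u k := iter k f 0.
have uS k : u k.+1 k = u k k.
  by elim: k => [|k IHk]; [rewrite !residue0 | apply: f_contr].
have coh n : (u n.+1 n.+1 %% 2 ^ n = u n n)%N by rewrite coherent uS.
exists (MkZ2 coh); apply: Z2P => -[|n]; first by rewrite !residue0.
exact: (f_contr n _ (u n)).
Qed.

(** The form of the fixed point theorem used to invert units and to find roots:
there [g] is a polynomial map, hence respects congruences. *)
Lemma affine_fixpoint (g : Z2 -> Z2) :
  (forall n (x y : Z2), x n = y n -> g x n = g y n) ->
  forall c, exists x, x = c + 2%:R * g x.
Proof.
move=> g_cong c.
case: (@contraction_fixpoint (fun x => c + 2%:R * g x)) => [n x y exy|x fx].
  by rewrite !residueD !residue_mul2 (g_cong _ _ _ exy).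
by exists x.
Qed.

Lemma half_coherent (x : Z2) n :
  ((x n.+2 %/ 2) %% 2 ^ n = x n.+1 %/ 2)%N.
Proof. by rewrite modn_divl mulnC -expnS coherent. Qed.

Definition half (x : Z2) : Z2 := MkZ2 (half_coherent x).

Lemma residue1_lt2 (x : Z2) : (x 1%N < 2)%N.
Proof. by rewrite -(residue_mod x) ltn_mod. Qed.

Definition red (x : Z2) : 'F_2 := (x 1%N)%:R.

Lemma red_is_zmod_morphism : zmod_morphism red.
Proof.
move=> x y; rewrite /red residueD residueN expn1 modnDmr.
move: (residue1_lt2 x) (residue1_lt2 y).
by case: (x 1%N) => [|[]] // _; case: (y 1%N) => [|[]] // _; apply/val_inj.
Qed.

Lemma red_is_monoid_morphism : monoid_morphism red.
Proof.
split=> [|x y]; first exact/val_inj.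
rewrite /red residueM expn1; move: (residue1_lt2 x) (residue1_lt2 y).
by case: (x 1%N) => [|[]] // _; case: (y 1%N) => [|[]] // _; apply/val_inj.
Qed.

HB.instance Definition _ :=
  GRing.isZmodMorphism.Build Z2 'F_2 red red_is_zmod_morphism.
HB.instance Definition _ :=
  GRing.isMonoidMorphism.Build Z2 'F_2 red red_is_monoid_morphism.

Lemma F2_cases (a : 'F_2) : a = 0 \/ a = 1.
Proof. by case: a => -[|[]] // i; [left | right]; apply: val_inj. Qed.

Lemma F2_neq0 (a : 'F_2) : a != 0 -> a = 1.
Proof. by case: (F2_cases a) => ->. Qed.

(** The digits of [x] beyond the first give the quotient [half x]. *)
Lemma even_Z2 x : red x = 0 -> exists y : Z2, x = 2%:R * y.
Proof.
move=> x0; exists (half x); apply: Z2P => -[|n]; first by rewrite !residue0.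
rewrite residue_mul2 /= mulnC divnK // /dvdn.
rewrite -[X in (_ %% X)%N](expn1 2) residue_le_mod //.
by move: (residue1_lt2 x) x0; rewrite /red; case: (x 1%N) => [|[]].
Qed.

Lemma odd_Z2 x : red x != 0 -> exists y : Z2, x = 1 + 2%:R * y.
Proof.
move=> /F2_neq0 x1; have [|y xE] := @even_Z2 (x - 1).
  by rewrite rmorphB rmorph1 /= x1 subrr.
by exists y; rewrite -xE addrC subrK.
Qed.

Lemma red2 : red 2%:R = 0.
Proof. by rewrite rmorph_nat; apply: val_inj. Qed.

Lemma Z2_cases (x : Z2) : exists y : Z2, x = 2%:R * y \/ x = 1 + 2%:R * y.
Proof.
have [/even_Z2[y ->]|/odd_Z2[y ->]] := eqVneq (red x) 0; exists y.
  by left.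
by right.
Qed.

(** The inverse of [1 + 2 t] is the fixed point of [y |-> 1 - 2 t y]. *)
Lemma Z2_mulVr_ex x : red x != 0 -> exists y, y * x = 1.
Proof.
case/odd_Z2=> t ->; case: (@affine_fixpoint (fun y => - (t * y)) _ 1).
  by move=> n y z eyz; rewrite !residueN !residueM eyz.
move=> y yE; exists y.
have -> : y * (1 + 2%:R * t) = y + 2%:R * (t * y) by ring.
by rewrite {1}yE; ring.
Qed.

(** The value at a non-unit is the one that the interface of rings with units
prescribes. *)
Definition Z2inv (x : Z2) : Z2 :=
  if pselect (exists y, y * x = 1) is left ex then projT1 (cid ex) else x.

Definition Z2unit : {pred Z2} := fun x => red x != 0.

Lemma Z2mulVr : {in Z2unit, left_inverse 1 Z2inv *%R}.
Proof.
move=> x ux; rewrite /Z2inv; case: pselect => [ex|[]]; first by case: cid.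
exact: Z2_mulVr_ex.
Qed.

Lemma Z2unitP (x y : Z2) : y * x = 1 -> x \in Z2unit.
Proof.
move=> /(congr1 red); rewrite rmorphM rmorph1 /= => yx; rewrite unfold_in /=.
by apply/eqP=> x0; move/eqP: yx; rewrite x0 mulr0 eq_sym oner_eq0.
Qed.

Lemma Z2inv_out : {in [predC Z2unit], Z2inv =1 id}.
Proof.
move=> x nux; rewrite /Z2inv; case: pselect => // -[y yx].
by case/negP: nux; apply: Z2unitP yx.
Qed.

HB.instance Definition _ :=
  GRing.ComNzRing_hasMulInverse.Build Z2 Z2mulVr Z2unitP Z2inv_out.

Lemma unit_Z2 (x : Z2) : (x \is a GRing.unit) = (red x != 0).
Proof. by []. Qed.

(** The instance of Hensel's lemma for a root near 0: a root [2 y] is a fixed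
point of [y |-> - b^-1 (c / 2 + 2 a y^2)]. *)
Lemma quadratic_root (a b c : Z2) : red b != 0 -> red c = 0 ->
  exists x, a * x ^+ 2 + b * x + c = 0.
Proof.
move=> ub /even_Z2[c' ->].
have [n x y exy|y yE] :=
    @affine_fixpoint (fun x => - (b^-1 * a * x * x)) _ (- (b^-1 * c')).
  by rewrite !residueN !residueM exy.
exists (2%:R * y); have bV : b * b^-1 = 1 by rewrite mulrV.
have -> : b * (2%:R * y) = - 2%:R * (b * b^-1) * (c' + 2%:R * (a * y * y)).
  by rewrite {1}yE; ring.
by rewrite bV; ring.
Qed.

(** Substituting [1 + 2 y] for [x] turns the equation into
[y^2 + y - 2 t = 0], which has a simple root modulo 2. *)
Lemma sqrt_1mod8 (t : Z2) : exists x, x ^+ 2 = 1 + 8%:R * t.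
Proof.
have [||y yE] := @quadratic_root 1 1 (- (2%:R * t)).
- by rewrite rmorph1.
- by rewrite rmorphN rmorphM /= red2 mul0r oppr0.
exists (1 + 2%:R * y).
move/eqP: yE; rewrite subr_eq0 => /eqP tE.
have -> : 8%:R * t = 4%:R * (2%:R * t) by ring.
by rewrite -tE; ring.
Qed.

Section Norm.
Variables (p : nat) (p_mod8 : p = 3 %[mod 8]).

Lemma p_mod8_Z2 : exists k : Z2, p%:R = 3%:R + 8%:R * k.
Proof.
exists (p %/ 8)%:R; rewrite {1}(divn_eq p 8) p_mod8 natrD natrM.
by rewrite -[(3 %% 8)%N]/3%N; ring.
Qed.

Lemma red_p : red p%:R = 1.
Proof.
have [k ->] := p_mod8_Z2; have -> : 3%:R + 8%:R * k = 1 + 2%:R * (1 + 4%:R * k) by ring.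
by rewrite rmorphD rmorphM rmorph1 /= red2 mul0r addr0.
Qed.

(** As [p = 3 mod 8], the norms [1, p, 1 + 4 p] and [4 + p] represent the units
modulo 8, and a unit that is 1 modulo 8 is a square. *)
Lemma unit_norm (u : Z2) : red u != 0 ->
  exists a b : Z2, u = a ^+ 2 + p%:R * b ^+ 2.
Proof.
have [k pE] := p_mod8_Z2; move=> /odd_Z2[v ->].
have pV : p%:R * p%:R^-1 = 1 :> Z2 by rewrite mulrV // unit_Z2 red_p oner_eq0.
have divp (w a : Z2) : a ^+ 2 = p%:R * w -> w = p%:R * (a / p%:R) ^+ 2.
  move=> aw; rewrite exprMn aw.
  have -> : p%:R * (p%:R * w * p%:R^-1 ^+ 2) = (p%:R * p%:R^-1) ^+ 2 * w by ring.
  by rewrite pV expr1n mul1r.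
have [w [->|->]] := Z2_cases v; have [t [->|->]] := Z2_cases w.
(* u = 1 + 8 t is a square *)
- have [x xE] := sqrt_1mod8 t; exists x, 0; rewrite xE; ring.
(* u = 5 + 8 t, and u - 4 p is 1 modulo 8 *)
- have [x xE] := sqrt_1mod8 (t - 1 - 4%:R * k); exists x, 2%:R.
  by rewrite xE pE; ring.
(* u = 3 + 8 t, and p u is 1 modulo 8 *)
- have [x xE] := sqrt_1mod8 (1 + 3%:R * t + 3%:R * k + 8%:R * t * k).
  exists 0, (x / p%:R); rewrite -(divp (3%:R + 8%:R * t)); first by ring.
  by rewrite xE pE; ring.
(* u = 7 + 8 t, and p (u - 4) is 1 modulo 8 *)
- have [x xE] := sqrt_1mod8 (1 + 3%:R * t + 3%:R * k + 8%:R * t * k).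
  exists 2%:R, (x / p%:R); rewrite -(divp (3%:R + 8%:R * t)); first by ring.
  by rewrite xE pE; ring.
Qed.

(** The equation says that [h(e + z f, e + z f)] takes a prescribed value, for
[z = c + d pi], when [f] is dual to [e] and [q = h(f, f)]: the value may be
changed by any even number. *)
Lemma norm_equation (g q : Z2) : red g = 0 -> exists c d : Z2,
  g + 2%:R * c + q * (c ^+ 2 + p%:R * d ^+ 2) = 0.
Proof.
move=> /even_Z2[h ->]; have [/even_Z2[q' ->]|uq] := eqVneq (red q) 0.
  (* Dividing by 2 leaves h + c + q' (c^2 + p d^2) = 0. If q' h is even, take d = 0
     and c near h; if q' h is odd, take d = 1, which makes the constant term
     h + q' p even. *)
  have [h0|/F2_neq0 h1] := eqVneq (red h) 0.
    have [//|//|c cE] := @quadratic_root q' 1 h.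
    exists c, 0; transitivity (2%:R * (q' * c ^+ 2 + 1 * c + h)); first by ring.
    by rewrite cE mulr0.
  have [q0|/F2_neq0 q1] := eqVneq (red q') 0.
    have [||c cE] := @quadratic_root q' (1 + 2%:R * q') (1 + q' + h).
    - exact: isT.
    - by rewrite !rmorphD rmorph1 /= q0 h1; apply: val_inj.
    exists (1 + c), 0.
    transitivity (2%:R * (q' * c ^+ 2 + (1 + 2%:R * q') * c + (1 + q' + h))).
      by ring.
    by rewrite cE mulr0.
  have [||c cE] := @quadratic_root q' 1 (h + q' * p%:R).
  - by rewrite rmorph1.
  - by rewrite rmorphD rmorphM /= h1 q1 red_p; apply: val_inj.
  exists c, 1; transitivity (2%:R * (q' * c ^+ 2 + 1 * c + (h + q' * p%:R))).
    by ring.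
  by rewrite cE mulr0.
(* Completing the norm: the equation says that 1 + q (c + d pi) has
   norm 1 - 2 q h. *)
have [//|a [b abE]] := @unit_norm (1 - 2%:R * q * h).
have qV : q * q^-1 = 1 by rewrite mulrV.
exists (q^-1 * (a - 1)), (q^-1 * b).
have -> : q * ((q^-1 * (a - 1)) ^+ 2 + p%:R * (q^-1 * b) ^+ 2) =
   (q * q^-1) * q^-1 * ((a ^+ 2 + p%:R * b ^+ 2) - 2%:R * a + 1) by ring.
rewrite -abE qV; have -> : 1 * q^-1 * (1 - 2%:R * q * h - 2%:R * a + 1) =
   2%:R * q^-1 * (1 - a) - 2%:R * (q * q^-1) * h by ring.
by rewrite qV; ring.
Qed.

End Norm.

(** * Modules as pairs of matrices, and Gram matrices *)

Notation redmx := (map_mx red).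

Lemma oppmx_F2 m n (A : 'M['F_2]_(m, n)) : - A = A.
Proof.
apply/matrixP => i j; rewrite !mxE.
by case: (F2_cases (A i j)) => ->; apply: val_inj.
Qed.

Lemma addmx_F2 m n (A : 'M['F_2]_(m, n)) : A + A = 0.
Proof. by rewrite -{1}[A]oppmx_F2 addNr. Qed.

Lemma red_unitmx n (A : 'M[Z2]_n) : (redmx A \in unitmx) = (A \in unitmx).
Proof. by rewrite !unitmxE det_map_mx unitfE unit_Z2. Qed.

Lemma even_mx m n (X : 'M[Z2]_(m, n)) : redmx X = 0 -> exists Y, X = 2%:R *: Y.
Proof.
move=> X0; have /(_ _ _)/cid H i j : exists y, X i j = 2%:R * y.
  by apply: even_Z2; have /matrixP/(_ i j) := X0; rewrite !mxE.
exists (\matrix_(i, j) projT1 (H i j)).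
by apply/matrixP => i j; rewrite !mxE; case: (H i j).
Qed.

Lemma mul2mx_inj m n : injective (fun X : 'M[Z2]_(m, n) => 2%:R *: X).
Proof.
move=> X Y /matrixP XY; apply/matrixP => i j; apply: mul2_inj.
by have := XY i j; rewrite !mxE.
Qed.

Definition lift2 (a : 'F_2) : Z2 := (a : nat)%:R.

Lemma lift2K : cancel lift2 red.
Proof. by move=> a; rewrite /lift2 rmorph_nat natr_Zp. Qed.

Lemma lift2mxK m n (A : 'M['F_2]_(m, n)) : redmx (map_mx lift2 A) = A.
Proof. by apply/matrixP => i j; rewrite !mxE lift2K. Qed.

(** With [J] the matrix of [pi] acting on row vectors and [S] the Gram matrix of
[psi], these are the axioms of a self-dual skew-Hermitian module on [Z_2^m].
Alternation amounts to antisymmetry because [Z_2] has no 2-torsion. *)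
Definition skew_pair p m (J S : 'M[Z2]_m) : Prop :=
  [/\ J *m J = (- p%:R)%:M, S^T = - S, J *m S = - (S *m J^T) & S \in unitmx].

Section Form.
Variables (p m : nat) (J S : 'M[Z2]_m).
Hypotheses (p_mod8 : p = 3 %[mod 8]) (JS : skew_pair p J S).

Implicit Types x y z f : 'rV[Z2]_m.

Definition gram r s (E : 'M[Z2]_(r, m)) (F : 'M_(s, m)) : 'M_(r, s) :=
  E *m S *m F^T.

Lemma gramDl r s (E F : 'M[Z2]_(r, m)) (G : 'M_(s, m)) :
  gram (E + F) G = gram E G + gram F G.
Proof. by rewrite /gram !mulmxDl. Qed.

Lemma gramDr r s (E F : 'M[Z2]_(r, m)) (G : 'M_(s, m)) :
  gram G (E + F) = gram G E + gram G F.
Proof. by rewrite /gram linearD mulmxDr. Qed.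

Lemma gramZl r s a (E : 'M[Z2]_(r, m)) (G : 'M_(s, m)) :
  gram (a *: E) G = a *: gram E G.
Proof. by rewrite /gram -!scalemxAl. Qed.

Lemma gramZr r s a (E : 'M[Z2]_(r, m)) (G : 'M_(s, m)) :
  gram G (a *: E) = a *: gram G E.
Proof. by rewrite /gram linearZ -scalemxAr. Qed.

Lemma gramMl q r s (P : 'M_(q, r)) (E : 'M[Z2]_(r, m)) (G : 'M_(s, m)) :
  gram (P *m E) G = P *m gram E G.
Proof. by rewrite /gram !mulmxA. Qed.

Lemma gramMr q r s (P : 'M_(q, r)) (E : 'M[Z2]_(r, m)) (G : 'M_(s, m)) :
  gram G (P *m E) = gram G E *m P^T.
Proof. by rewrite /gram trmx_mul !mulmxA. Qed.

Lemma gram_col_mx q r s t (E : 'M[Z2]_(q, m)) (F : 'M[Z2]_(r, m))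
    (G : 'M[Z2]_(s, m)) (H : 'M[Z2]_(t, m)) :
  gram (col_mx E F) (col_mx G H) =
    block_mx (gram E G) (gram E H) (gram F G) (gram F H).
Proof. by rewrite /gram tr_col_mx mul_col_mx mul_col_row. Qed.

Lemma gram_col_mxl q r s (E : 'M[Z2]_(q, m)) (F : 'M[Z2]_(r, m))
    (G : 'M[Z2]_(s, m)) :
  gram (col_mx E F) G = col_mx (gram E G) (gram F G).
Proof. by rewrite /gram !mul_col_mx. Qed.

Lemma tr_gram r s (E : 'M[Z2]_(r, m)) (F : 'M_(s, m)) :
  (gram E F)^T = - gram F E.
Proof.
have [_ ST _ _] := JS.
by rewrite /gram !trmx_mul trmxK ST mulNmx mulmxN mulmxA.
Qed.

Lemma gram_adj r s (E : 'M[Z2]_(r, m)) (F : 'M_(s, m)) :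
  gram (E *m J) F = - gram E (F *m J).
Proof.
have [_ _ SJ _] := JS.
by rewrite /gram trmx_mul -(mulmxA E J) SJ mulmxN mulNmx !mulmxA.
Qed.

Lemma mulJJ r (E : 'M[Z2]_(r, m)) : E *m J *m J = - p%:R *: E.
Proof. by have [JJ _ _ _] := JS; rewrite -mulmxA JJ mul_mx_scalar. Qed.

Lemma gram_JJ r s (E : 'M[Z2]_(r, m)) (F : 'M_(s, m)) :
  gram (E *m J) (F *m J) = p%:R *: gram E F.
Proof. by rewrite gram_adj mulJJ gramZr scaleNr opprK. Qed.

Definition pairing x y : Z2 := gram x y 0 0.

Lemma pairingDl x y z : pairing (x + y) z = pairing x z + pairing y z.
Proof. by rewrite /pairing gramDl mxE. Qed.

Lemma pairingDr x y z : pairing z (x + y) = pairing z x + pairing z y.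
Proof. by rewrite /pairing gramDr mxE. Qed.

Lemma pairingZl a x y : pairing (a *: x) y = a * pairing x y.
Proof. by rewrite /pairing gramZl mxE. Qed.

Lemma pairingZr a x y : pairing y (a *: x) = a * pairing y x.
Proof. by rewrite /pairing gramZr mxE. Qed.

Lemma pairing_sym x y : pairing x y = - pairing y x.
Proof.
have -> : pairing x y = (gram x y)^T 0 0 by rewrite mxE.
by rewrite tr_gram mxE.
Qed.

Lemma pairing_alt x : pairing x x = 0.
Proof.
by apply: mul2_inj => /=; rewrite mulr0 mulr_natl mulr2n {1}pairing_sym addNr.
Qed.

Lemma pairing_adj x y : pairing (x *m J) y = - pairing x (y *m J).
Proof. by rewrite /pairing gram_adj mxE. Qed.

Lemma pairing_adjC x y : pairing (x *m J) y = pairing (y *m J) x.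
Proof. by rewrite pairing_adj -pairing_sym. Qed.

Lemma pairing_JJ x y : pairing (x *m J) (y *m J) = p%:R * pairing x y.
Proof. by rewrite /pairing gram_JJ mxE. Qed.

Lemma gram_row r s (E : 'M_(r, m)) (F : 'M_(s, m)) i j :
  gram E F i j = pairing (row i E) (row j F).
Proof.
by rewrite /pairing /gram -!row_mul !mxE; apply: eq_bigr => k _; rewrite !mxE.
Qed.

(** The value of [x |-> h(x, x) = psi(pi x, x)] at [x + (c + d pi) f]. *)
Lemma norm_translate x f c d :
  pairing ((x + c *: f + d *: (f *m J)) *m J) (x + c *: f + d *: (f *m J)) =
    pairing (x *m J) x + 2%:R * c * pairing (f *m J) x
    - 2%:R * p%:R * d * pairing f x + (c ^+ 2 + p%:R * d ^+ 2) * pairing (f *m J) f.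
Proof.
rewrite !mulmxDl -!scalemxAl mulJJ !(pairingDl, pairingDr, pairingZl, pairingZr).
rewrite (pairing_adjC x f) pairing_JJ (pairing_sym x f) pairing_JJ !pairing_alt.
rewrite (pairing_sym f (f *m J)); ring.
Qed.

Section Adjust.
Variables (r : nat) (A : 'M['F_2]_r).
Hypotheses (Aunit : A \in unitmx) (Asym : A^T = A).
Implicit Type e : 'I_r -> 'rV[Z2]_m.

(** The residue class of [h(e_i, e_j)] is [A i j]. *)
Definition lifts_gram e :=
  forall i j, red (pairing (e i *m J) (e j) + pairing (e i) (e j)) = A i j.

(** [h(e_i, e_j)] is the rational integer 0 or 1 lifting [A i j]: its
[pi]-coordinate [psi(e_i, e_j)] vanishes. *)
Definition exact_at e i j :=
  pairing (e i) (e j) = 0 /\ pairing (e i *m J) (e j) = lift2 (A i j).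

Lemma exact_at_sym e i j : exact_at e i j -> exact_at e j i.
Proof.
move=> [h1 h2]; split; first by rewrite pairing_sym h1 oppr0.
by rewrite pairing_adjC h2 -{1}Asym mxE.
Qed.

(** Modulo 2 the Gram matrix of the [e_i] and [pi e_i] is [[U, T], [T, U]] with
[U + T = A]; adding rows and columns makes it block triangular with both
diagonal blocks equal to [A]. *)
Lemma gram_unit e (E := \matrix_i e i) (Q := col_mx E (E *m J)) :
  lifts_gram e -> gram Q Q \in unitmx.
Proof.
move=> eA; rewrite -red_unitmx /Q gram_col_mx map_block_mx.
set U := redmx (gram E E); set T := redmx (gram (E *m J) E).
have TU : T + U = A.
  apply/matrixP => i j; have rE k : row k E = e k by rewrite rowK.
  by rewrite -eA mxE ![(redmx _) i j]mxE !gram_row row_mul !rE rmorphD.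
have -> : redmx (gram E (E *m J)) = T.
  by rewrite -[gram E _]opprK -gram_adj map_mxN oppmx_F2.
have -> : redmx (gram (E *m J) (E *m J)) = U.
  by rewrite gram_JJ map_mxZ /= red_p // scale1r.
pose L := block_mx (1%:M : 'M['F_2]_r) 0 1%:M (1%:M : 'M_r).
have Lu : L *m block_mx U T T U *m L = block_mx A T 0 A.
  rewrite /L !mulmx_block !mul1mx !mul0mx !mulmx1 !mulmx0 !addr0 !add0r.
  by rewrite addrC TU addmx_F2.
have : L *m block_mx U T T U *m L \in unitmx.
  by rewrite Lu unitmxE det_ublock unitrM -unitmxE Aunit.
by rewrite !unitmx_mul => /andP[/andP[]].
Qed.

(** A vector [f] with [h(f, e_j) = 0] for [j <> k] and [h(f, e_k) = 1], found
in the span of the [e_j] and [pi e_j] by inverting their Gram matrix. *)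
Lemma dual_vector e k : lifts_gram e ->
  exists f, forall j, pairing f (e j) = 0 /\ pairing (f *m J) (e j) = (j == k)%:R.
Proof.
move=> eA; have := gram_unit eA; set E := \matrix_i e i; set Q := col_mx _ _.
move=> Gu; pose c : 'rV[Z2]_(r + r) := row_mx 0 (- delta_mx 0 k).
pose f := c *m invmx (gram Q Q) *m Q; exists f => j.
have : gram f Q = c by rewrite /f gramMl -mulmxA mulVmx // mulmx1.
have rE : row j E = e j by rewrite rowK.
have f0 : row 0 f = f by apply/rowP => l; rewrite !mxE.
rewrite /gram /Q tr_col_mx mul_mx_row => /eq_row_mx[fE fEJ]; split.
  by rewrite -rE -f0 -gram_row [gram _ _]fE mxE.
rewrite pairing_adj -rE -row_mul -f0 -gram_row [gram _ _]fEJ !mxE opprK eqxx.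
by [].
Qed.

(** Replacing a single vector requires checking a single row, by Hermitian
symmetry. *)
Lemma lifts_gram_row e e' k : lifts_gram e -> (forall j, j != k -> e' j = e j) ->
  red (pairing (e' k *m J) (e' k)) = red (pairing (e k *m J) (e k)) ->
  (forall j, j != k -> red (pairing (e' k *m J) (e j) + pairing (e' k) (e j)) = A k j) ->
  lifts_gram e'.
Proof.
move=> eA e'E e'k e'j i j.
have [->|nik] := eqVneq i k.
  have [->|njk] := eqVneq j k; last by rewrite (e'E j) // e'j.
  by rewrite pairing_alt addr0 e'k -eA pairing_alt addr0.
have [->|njk] := eqVneq j k; last by rewrite !e'E.
rewrite (e'E i) // pairing_adjC (pairing_sym (e i) (e' k)) -Asym mxE -e'j //.
rewrite rmorphB rmorphD /=.
by have [->|->] := F2_cases (red (pairing (e' k) (e i))); apply: val_inj.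
Qed.

Lemma exact_at_row e e' k : (forall j, j != k -> e' j = e j) ->
    (forall j, j != k -> exact_at e k j -> exact_at e' k j) ->
  forall a b, a != b -> exact_at e a b -> exact_at e' a b.
Proof.
move=> e'E keep a b nab; have [ak|nak] := eqVneq a k.
  by rewrite ak in nab *; apply: keep; rewrite eq_sym.
have [->|nbk] := eqVneq b k; last by rewrite /exact_at !e'E.
by move=> /exact_at_sym h; apply/exact_at_sym/keep.
Qed.

(** Add to [e_k] the multiple of the dual vector of [e_i] by the defect [z] of
[h(e_k, e_i)].  As [z] reduces to 0, its norm is even and [h(e_k, e_k)] keeps its
residue class. *)
Lemma adjust_offdiagonal e i k : lifts_gram e -> i != k ->
  exists e', [/\ lifts_gram e', exact_at e' i k &
    forall a b, a != b -> exact_at e a b -> exact_at e' a b].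
Proof.
move=> eA nik; have [f fE] := dual_vector i eA.
(* the defect of h(e_k, e_i), with coordinates c and d *)
pose c := lift2 (A k i) - pairing (e k *m J) (e i); pose d := - pairing (e k) (e i).
pose x := e k + c *: f + d *: (f *m J).
pose e' j := if j == k then x else e j.
have e'k : e' k = x by rewrite /e' eqxx.
have e'E j : j != k -> e' j = e j by rewrite /e' => /negPf->.
have xE j : pairing x (e j) = pairing (e k) (e j) + d * (j == i)%:R.
  by have [f1 f2] := fE j; rewrite /x !(pairingDl, pairingZl) f1 f2 mulr0 addr0.
have xJE j : pairing (x *m J) (e j) = pairing (e k *m J) (e j) + c * (j == i)%:R.
  have [f1 f2] := fE j; rewrite /x !mulmxDl -!scalemxAl mulJJ !(pairingDl, pairingZl).
  by rewrite f1 f2 !mulr0 addr0.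
have exki : exact_at e' k i.
  rewrite /exact_at e'k (e'E i) // xE xJE eqxx !mulr1 /c /d; split; ring.
have keep j : j != k -> exact_at e k j -> exact_at e' k j.
  have [->|nji] := eqVneq j i; first by [].
  by move=> njk; rewrite /exact_at e'k e'E // xE xJE (negPf nji) !mulr0 !addr0.
exists e'; split; last 1 first.
- exact: (exact_at_row e'E).
- apply: (lifts_gram_row (k := k) eA e'E).
    have [f1 f2] := fE k; rewrite e'k /x norm_translate f1 f2 eq_sym (negPf nik).
    rewrite !mulr0 addr0 subr0 rmorphD rmorphM /= [X in X * _](_ : _ = 0) ?mul0r ?addr0 //.
    rewrite rmorphD rmorphM !rmorphXn /= red_p // mul1r.
    have := eA k i; rewrite rmorphD /c /d rmorphB rmorphN /= lift2K => <-.
    move: (red (pairing (e k *m J) (e i))) (red (pairing (e k) (e i))) => u v.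
    by case: (F2_cases u) => ->; case: (F2_cases v) => ->; apply: val_inj.
  move=> j njk; rewrite e'k xE xJE; have [->|nji] := eqVneq j i.
    by rewrite !mulr1 /c /d subrr addr0 addrC subrK lift2K.
  by rewrite !mulr0 !addr0.
- exact: exact_at_sym.
Qed.

(** Adding a multiple of the dual vector of [e_k] leaves all [h(e_k, e_j)] with
[j <> k] alone; the multiple comes from [norm_equation]. *)
Lemma adjust_diagonal e k : lifts_gram e ->
  exists e', [/\ lifts_gram e', pairing (e' k *m J) (e' k) = lift2 (A k k),
    forall j, j != k -> e' j = e j &
    forall a b, a != b -> exact_at e a b -> exact_at e' a b].
Proof.
move=> eA; have [f fE] := dual_vector k eA; have [f1 f2] := fE k.
have [|c [d cd]] :=
    norm_equation p_mod8 (g := pairing (e k *m J) (e k) - lift2 (A k k))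
                  (pairing (f *m J) f).
  by rewrite rmorphB /= lift2K -eA pairing_alt addr0 subrr.
pose x := e k + c *: f + d *: (f *m J).
pose e' j := if j == k then x else e j.
have e'k : e' k = x by rewrite /e' eqxx.
have e'E j : j != k -> e' j = e j by rewrite /e' => /negPf->.
have xE j : j != k -> pairing x (e j) = pairing (e k) (e j).
  move=> njk; have [h1 h2] := fE j; rewrite /x !(pairingDl, pairingZl) h1 h2.
  by rewrite (negPf njk) !mulr0 !addr0.
have xJE j : j != k -> pairing (x *m J) (e j) = pairing (e k *m J) (e j).
  move=> njk; have [h1 h2] := fE j.
  rewrite /x !mulmxDl -!scalemxAl mulJJ !(pairingDl, pairingZl) h1 h2.
  by rewrite (negPf njk) !mulr0 !addr0.
have e'kk : pairing (e' k *m J) (e' k) = lift2 (A k k).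
  by rewrite e'k /x norm_translate f1 f2 eqxx mulr0 subr0 mulr1 -[RHS]addr0 -cd; ring.
exists e'; split=> //.
  apply: (lifts_gram_row (k := k) eA e'E).
    by rewrite e'kk lift2K -eA pairing_alt addr0.
  by move=> j njk; rewrite e'k xE // xJE.
apply: (exact_at_row e'E) => j njk.
by rewrite /exact_at e'k e'E // xE // xJE.
Qed.

(** All off-diagonal values are corrected before the diagonal ones, since an
off-diagonal correction also changes a diagonal value. *)
Lemma exact_lift e : lifts_gram e -> exists E : 'M_(r, m),
  gram E E = 0 /\ gram (E *m J) E = map_mx lift2 A.
Proof.
move=> eA.
have [e1 [e1A e1E]] : exists e1, lifts_gram e1 /\
    forall i j, i != j -> exact_at e1 i j.
  suff [e1 [e1A e1E]] : exists e1, lifts_gram e1 /\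
      {in enum {: 'I_r * 'I_r}, forall ij, ij.1 != ij.2 -> exact_at e1 ij.1 ij.2}.
    by exists e1; split=> // i j; apply: (e1E (i, j)); rewrite mem_enum.
  elim: (enum _) => [|[i k] s [e1 [e1A e1E]]]; first by exists e.
  have [eik|nik] := eqVneq i k.
    exists e1; split=> // ij; rewrite inE => /predU1P[->|]; last exact: e1E.
    by rewrite eik eqxx.
  have [e2 [e2A e2ik e2E]] := adjust_offdiagonal e1A nik.
  exists e2; split=> // ij; rewrite inE => /predU1P[-> //|ijs nij].
  exact/e2E/e1E.
have [e2 [e2A e2E e2D]] : exists e2, [/\ lifts_gram e2,
    forall i j, i != j -> exact_at e2 i j &
    {in enum 'I_r, forall k, pairing (e2 k *m J) (e2 k) = lift2 (A k k)}].
  elim: (enum _) => [|k s [e2 [e2A e2E e2D]]]; first by exists e1.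
  have [e3 [e3A e3k e3j e3E]] := adjust_diagonal k e2A.
  exists e3; split=> // [i j nij|j]; first exact/e3E/e2E.
  rewrite inE; have [-> //|njk] := eqVneq j k.
  by rewrite e3j //; apply: e2D.
exists (\matrix_i e2 i); split; apply/matrixP => i j;
  rewrite gram_row ?row_mul !rowK !mxE.
  by have [->|/e2E[]] := eqVneq i j; first exact: pairing_alt.
by have [->|/e2E[]] := eqVneq i j; first by apply: e2D; rewrite mem_enum.
Qed.

End Adjust.
End Form.

(** * Orthogonal bases and the normal form *)

Section Rank.
Variables (F : fieldType) (m : nat) (B : 'M[F]_m).

(** A symmetric matrix of rank [r] induces a non-degenerate form on a complement
of its kernel; the rows of [E] are a basis of such a complement. *)
Lemma symmetric_minor : B^T = B ->
  exists E : 'M_(\rank B, m), E *m B *m E^T \in unitmx.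
Proof.
move=> Bsym; have [E EB] : exists E, E *m B = row_base B.
  exists (pinvmx (col_base B)).
  have := congr1 (mulmx (pinvmx (col_base B))) (mulmx_base B).
  by rewrite mulmxA mulVpmx ?col_base_full // mul1mx.
exists E; rewrite EB -row_free_unit /row_free eqn_leq rank_leq_row /=.
apply: leq_trans (mxrankM_maxr (col_base B) _).
rewrite mulmxA mulmx_base; have -> : B *m E^T = (row_base B)^T.
  by rewrite -EB trmx_mul Bsym.
by rewrite mxrank_tr eq_row_base.
Qed.

(** The rows of [E] span a complement of the radical of [B], so a vector
orthogonal to them lies in the radical. *)
Lemma minor_kernel r (E : 'M_(r, m)) (x : 'rV_m) : \rank B = r ->
  E *m B *m E^T \in unitmx -> x *m B *m E^T = 0 -> x *m B = 0.
Proof.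
move=> rB Eu xBE.
have rEB : \rank (E *m B) = \rank B.
  rewrite rB.
  apply/eqP; rewrite eqn_leq rank_leq_row /=.
  by rewrite -{1}(mxrank_unit Eu) mxrankM_maxl.
have /submxP[c xB] : (x *m B <= E *m B)%MS.
  apply: submx_trans (submxMl x B) _.
  by rewrite -(mxrank_leqif_sup (submxMl E B)) rEB.
rewrite xB -!mulmxA in xBE *; move: xBE; rewrite (mulmxA E) => /(canRL (mulmxK Eu)).
by rewrite mul0mx => ->; rewrite mul0mx.
Qed.

End Rank.

Lemma p_odd p : p = 3 %[mod 8] -> odd p.
Proof. by move=> p_mod8; rewrite (divn_eq p 8) oddD oddM p_mod8 andbF. Qed.

Section Standard.
Variable p : nat.

Definition halfp1 : Z2 := (p.+1)./2%:R.

(** The action of [pi] in the basis [e_i, pi e_i, v_j, w_j], where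
[w_j = (v_j + pi v_j) / 2]. *)
Definition stdJ r s : 'M[Z2]_((r + r) + (s + s)) :=
  block_mx (block_mx 0 1%:M (- p%:R)%:M 0) 0
           0 (block_mx (- 1)%:M 2%:R%:M (- halfp1)%:M 1%:M).

Definition antidiag r (A : 'M[Z2]_r) : 'M_(r + r) := block_mx 0 (- A) A 0.

(** In the basis of [stdJ], the alternating form whose only non-zero values are,
up to antisymmetry, the [psi(pi e_i, e_j)], which lift [A i j], and
[psi(w_j, v_j) = 1]. *)
Definition stdS r s (A : 'M['F_2]_r) : 'M[Z2]_((r + r) + (s + s)) :=
  block_mx (antidiag (map_mx lift2 A)) 0 0 (antidiag 1%:M).

Lemma antidiag_unit r (A : 'M[Z2]_r) : A \in unitmx -> antidiag A \in unitmx.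
Proof.
move=> Au; have [|//] := @mulmx1_unit _ _ (antidiag A) (block_mx 0 (invmx A) (- invmx A) 0).
rewrite /antidiag mulmx_block !mul0mx !mulmx0 add0r !addr0 mulmxN mulNmx opprK mulmxV //.
by rewrite scalar_mx_block.
Qed.

Lemma tr_antidiag r (A : 'M[Z2]_r) : A^T = A -> (antidiag A)^T = - antidiag A.
Proof.
by move=> As; rewrite tr_block_mx opp_block_mx !trmx0 linearN /= As opprK oppr0.
Qed.

Lemma stdS_unit r s (A : 'M['F_2]_r) : A \in unitmx -> stdS s A \in unitmx.
Proof.
move=> Au; rewrite unitmxE det_ublock unitrM -!unitmxE.
by rewrite !antidiag_unit ?unitmx1 // -red_unitmx lift2mxK.
Qed.

Lemma double_halfp1 : odd p -> 2%:R * halfp1 = p%:R + 1.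
Proof.
by move=> op; rewrite /halfp1 -natrM mul2n even_halfK /= ?op // -natr1.
Qed.

Lemma stdJS r s (A : 'M['F_2]_r) (At := map_mx lift2 A) :
  stdJ r s *m stdS s A =
    block_mx (block_mx At 0 0 (p%:R *: At)) 0
             0 (block_mx 2%:R%:M 1%:M 1%:M (halfp1)%:M).
Proof.
rewrite /stdJ /stdS /antidiag !mulmx_block !mul0mx !mulmx0 !addr0 !add0r ?mulmx_block.
rewrite !mul1mx !mulmx1 ?addr0 ?add0r ?mul_mx_scalar ?mul_scalar_mx.
by rewrite !scalerN !scaleNr !opprK !scale1r scalemx1.
Qed.

(** Every symmetric invertible matrix over F_2 is thus realized by a self-dual
module, for every rank of the complement. *)
Lemma std_skew_pair r s (A : 'M['F_2]_r) : odd p -> A \in symGL r ->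
  skew_pair p (stdJ r s) (stdS s A).
Proof.
move=> op; rewrite inE => /andP[Au /eqP As].
have AsZ : (map_mx lift2 A)^T = map_mx lift2 A by rewrite map_trmx As.
split; last exact: stdS_unit.
- rewrite /stdJ mulmx_block !mul0mx !mulmx0 !addr0 !add0r !mulmx_block.
  rewrite !mul0mx !mulmx0 !mul1mx !mulmx1 !addr0 !add0r.
  rewrite -!scalar_mxM -!raddfD /=.
  have -> : -1 * -1 + 2%:R * - halfp1 = - p%:R.
    transitivity (1 - 2%:R * halfp1); first by ring.
    by rewrite double_halfp1 //; ring.
  have -> : - halfp1 * 2%:R + 1 = - p%:R.
    transitivity (1 - 2%:R * halfp1); first by ring.
    by rewrite double_halfp1 //; ring.
  have -> : -1 * 2%:R + 2%:R = 0 :> Z2 by ring.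
  have -> : - halfp1 * -1 - halfp1 = 0 by ring.
  by rewrite !raddf0 -!scalar_mx_block.
- by rewrite /stdS tr_block_mx !trmx0 !tr_antidiag ?trmx1 // [in RHS]opp_block_mx !oppr0.
- rewrite stdJS /stdJ /stdS tr_block_mx !trmx0 !mulmx_block !mul0mx !mulmx0.
  rewrite !addr0 !add0r opp_block_mx !oppr0 /antidiag !tr_block_mx !mulmx_block.
  rewrite !opp_block_mx !trmx0 !tr_scalar_mx !mul0mx !mulmx0 !mul1mx !mulmx1.
  rewrite !addr0 !add0r ?mul_mx_scalar ?mul_scalar_mx.
  by rewrite !scaleNr !scalerN !opprK !oppr0 -!raddfN /= !opprK !scalemx1.
Qed.

End Standard.

(** The matrix of [Z_2^m -> F_2^r] sending [e_i] and [pi e_i] to the [i]-th basis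
vector and the [v_j] and [w_j] to 0. *)
Definition rowsum r s : 'M['F_2]_(r, (r + r) + (s + s)) :=
  row_mx (row_mx 1%:M 1%:M) 0.

Lemma rowsum_right_inverse r s : exists X, rowsum r s *m X = 1%:M.
Proof.
exists (col_mx (col_mx 1%:M 0) 0).
by rewrite /rowsum !mul_row_col !mulmx0 !addr0 mulmx1.
Qed.

(** The form [psi((1 + pi) x, y) mod 2] of the standard module is the pullback of
[A], from which [r] and the class of [A] can be read off. *)
Lemma stdS_reduction p r s (A : 'M['F_2]_r) : p = 3 %[mod 8] ->
  redmx ((1%:M + stdJ p r s) *m stdS s A) =
    (rowsum r s)^T *m A *m rowsum r s.
Proof.
move=> p_mod8; have [k pE] := p_mod8_Z2 p_mod8.
have red_h : red (halfp1 p) = 0.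
  have -> : halfp1 p = 2%:R * (1 + 2%:R * k).
    apply: mul2_inj; rewrite /= double_halfp1 ?(p_odd p_mod8) // pE; ring.
  by rewrite rmorphM /= red2 mul0r.
rewrite mulmxDl mul1mx stdJS /stdS /antidiag !add_block_mx !add0r !addr0.
rewrite !map_block_mx !map_mxD !map_mxN map_mxZ !map_scalar_mx !lift2mxK.
rewrite !oppmx_F2 /= red2 red_h red_p // scale1r !map_mx0 !addmx_F2 raddf0.
rewrite /rowsum !tr_row_mx trmx1 trmx0 !mul_col_mx mul1mx mul0mx.
rewrite !mul_mx_row !mulmx1 !mulmx0.
rewrite -/(block_mx (row_mx A A) 0 (row_mx A A) 0) [in RHS]block_mxEh.
by rewrite !block_mx0 !row_mx0 col_mx0 [LHS]/block_mx row_mx0.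
Qed.

Lemma gram_unit_size m k (S : 'M[Z2]_m) (Q : 'M_(k, m)) :
  gram S Q Q \in unitmx -> (k <= m)%N.
Proof.
rewrite -red_unitmx /gram -mulmxA map_mxM => /mxrank_unit {1}<-.
by rewrite (leq_trans (mxrankM_maxl _ _)) // rank_leq_col.
Qed.

Section Complement.
Variables (p m : nat) (J S : 'M[Z2]_m).
Hypotheses (p_mod8 : p = 3 %[mod 8]) (JS : skew_pair p J S).
Variables (r : nat) (A : 'M['F_2]_r) (E : 'M[Z2]_(r, m)).
Hypotheses (A_symGL : A \in symGL r).
Hypotheses (EE : gram S E E = 0) (EJE : gram S (E *m J) E = map_mx lift2 A).
Hypothesis (rB : \rank (redmx ((1%:M + J) *m S)) = r).

(** The conditions on vectors [v_j], the rows of [V], and on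
[w_j = (v_j + pi v_j) / 2] to be orthonormal over the maximal order, up to the
factor 2 of [h], and orthogonal to the [e_i] and [pi e_i], the rows of [E] and of
[E *m J]. *)
Definition unramified_part j (V W : 'M[Z2]_(j, m)) : Prop :=
  [/\ V + V *m J = 2%:R *: W, gram S V V = 0, gram S (V *m J) V = 2%:R%:M,
      gram S V E = 0 & gram S (V *m J) E = 0].

Definition frame j (V W : 'M[Z2]_(j, m)) := col_mx (col_mx E (E *m J)) (col_mx V W).

Let gramJr a b (X : 'M_(a, m)) (Y : 'M_(b, m)) :
  gram S X (Y *m J) = - gram S (X *m J) Y.
Proof. by rewrite (gram_adj JS) opprK. Qed.

Let gramC a b (X : 'M_(a, m)) (Y : 'M_(b, m)) : gram S X Y = - (gram S Y X)^T.
Proof. by rewrite (tr_gram JS) opprK. Qed.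

Lemma frame_J j (V W : 'M_(j, m)) : unramified_part V W ->
  frame V W *m J = stdJ p r j *m frame V W.
Proof.
case=> VW _ _ _ _.
have VJ : V *m J = 2%:R *: W - V by rewrite -VW addrC addKr.
have WJ : W *m J = W - halfp1 p *: V.
  apply: mul2mx_inj => /=.
  rewrite scalemxAl -VW mulmxDl (mulJJ JS) VJ scalerBr scalerA.
  by rewrite double_halfp1 ?(p_odd p_mod8) //; apply/matrixP => a b; rewrite !mxE; ring.
rewrite /frame !mul_col_mx (mulJJ JS) VJ WJ /stdJ !mul_row_col !mul0mx addr0 add0r.
rewrite !mul_block_col !mul0mx !mul1mx add0r addr0 !mul_scalar_mx.
by congr (col_mx _ (col_mx _ _)); apply/matrixP => a b; rewrite !mxE; ring.
Qed.

Lemma frame_gram j (V W : 'M_(j, m)) : unramified_part V W ->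
  gram S (frame V W) (frame V W) = stdS j A.
Proof.
case=> VW VV VJV VE VJE.
have EW2 a (X : 'M_(a, m)) : 2%:R *: gram S X W = gram S X V - gram S (X *m J) V.
  by rewrite -gramZr -VW gramDr gramJr.
have AsZ : (map_mx lift2 A)^T = map_mx lift2 A.
  by move: A_symGL; rewrite inE map_trmx => /andP[_ /eqP->].
have EV : gram S E V = 0 by rewrite gramC VE trmx0 oppr0.
have EJV : gram S (E *m J) V = 0 by rewrite (gram_adj JS) gramC VJE trmx0 !oppr0.
have EW : gram S E W = 0.
  by apply: mul2mx_inj; rewrite /= EW2 EV EJV subrr scaler0.
have EJW : gram S (E *m J) W = 0.
  apply: mul2mx_inj; rewrite /= EW2 (mulJJ JS) gramZl EJV EV.
  by rewrite !scaler0 subrr.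
have VW1 : gram S V W = - 1%:M.
  by apply: mul2mx_inj; rewrite /= EW2 VV VJV add0r scalerN scalemx1.
have WV1 : gram S W V = 1%:M by rewrite gramC VW1 linearN /= trmx1 opprK.
have WJV : gram S (W *m J) V = 1%:M.
  apply: mul2mx_inj => /=.
  rewrite -gramZl scalemxAl -VW mulmxDl gramDl (mulJJ JS) gramZl VV VJV.
  by rewrite scaler0 addr0 scalemx1.
have WW : gram S W W = 0.
  by apply: mul2mx_inj; rewrite /= EW2 WV1 WJV subrr scaler0.
rewrite /frame !gram_col_mx (gram_JJ JS) EE gramJr EJE EV EW EJV EJW VV VW1 WV1 WW.
have -> : gram S V (E *m J) = 0 by rewrite gramJr VJE oppr0.
have -> : gram S W (E *m J) = 0 by rewrite gramC EJW trmx0 oppr0.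
have -> : gram S W E = 0 by rewrite gramC EW trmx0 oppr0.
by rewrite VE scaler0 /stdS /antidiag !block_mx0.
Qed.

(** The orthogonal projection along the span of the frame, whose Gram matrix is
invertible. *)
Definition project j (V W : 'M[Z2]_(j, m)) (z : 'rV_m) : 'rV_m :=
  z - gram S z (frame V W) *m invmx (stdS j A) *m frame V W.

Let A_unit : A \in unitmx. Proof. by move: A_symGL; rewrite inE => /andP[]. Qed.

Lemma project_orth j (V W : 'M_(j, m)) z : unramified_part V W ->
  gram S (project V W z) (frame V W) = 0.
Proof.
move=> VW; rewrite /project gramDl -mulNmx gramMl frame_gram // mulNmx mulmxKV ?subrr //.
exact: stdS_unit.
Qed.

Lemma pairing_project j (V W : 'M_(j, m)) x z : gram S x (frame V W) = 0 ->
  pairing S x (project V W z) = pairing S x z.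
Proof.
move=> xQ; rewrite /project pairingDr -mulNmx {2}/pairing gramMr xQ mul0mx mxE.
by rewrite addr0.
Qed.

Lemma orth_J j (V W : 'M_(j, m)) (x : 'rV_m) : unramified_part V W ->
  gram S x (frame V W) = 0 -> gram S (x *m J) (frame V W) = 0.
Proof.
by move=> VW xQ; rewrite (gram_adj JS) (frame_J VW) gramMr xQ mul0mx oppr0.
Qed.

(** On the complement of the [e_i] the form [psi((1 + pi) x, y)] is even, since
the [e_i] exhaust its rank modulo 2; as [psi] is unimodular, [(1 + pi) x] itself
is divisible by 2. *)
Lemma orth_halvable j (V W : 'M_(j, m)) (x : 'rV_m) : unramified_part V W ->
  gram S x (frame V W) = 0 -> exists w, x + x *m J = 2%:R *: w.
Proof.
move=> VW xQ; have xJQ := orth_J VW xQ; apply: even_mx.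
have orthE (y : 'rV_m) : gram S y (frame V W) = 0 -> gram S y E = 0.
  rewrite /gram /frame !tr_col_mx !mul_mx_row => /eqP.
  by rewrite !row_mx_eq0 => /andP[/andP[/eqP]].
have {orthE} xE : gram S (x + x *m J) E = 0 by rewrite gramDl !orthE // addr0.
pose B := redmx ((1%:M + J) *m S).
have redS : redmx S \in unitmx by rewrite red_unitmx; have [] := JS.
have xB : redmx x *m B = redmx ((x + x *m J) *m S).
  by rewrite -map_mxM mulmxA mulmxDr mulmx1.
suff : redmx x *m B = 0.
  by rewrite xB map_mxM => /(canRL (mulmxK redS)); rewrite mul0mx.
have EBE : redmx E *m B *m (redmx E)^T = A.
  rewrite map_trmx -!map_mxM mulmxA mulmxDr mulmx1 [_ *m S *m _]gramDl EE EJE.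
  by rewrite add0r lift2mxK.
have xBE : redmx x *m B *m (redmx E)^T = 0.
  by rewrite xB map_trmx -map_mxM [_ *m S *m _]xE map_mx0.
by apply: minor_kernel xBE; rewrite ?EBE.
Qed.

Lemma orth_primitive j (V W : 'M_(j, m)) : unramified_part V W ->
  (r + r + (j + j) < m)%N ->
  exists x : 'rV_m, gram S x (frame V W) = 0 /\ redmx x != 0.
Proof.
move=> VW lt_m; set Q := frame V W.
have /row_subPn[i iQ] : ~~ (1%:M <= redmx Q)%MS.
  apply: contraL lt_m => /mxrankS; rewrite mxrank1 -leqNgt => /leq_trans-> //.
  exact: rank_leq_row.
exists (project V W (row i 1%:M)); split; first exact: project_orth.
apply: contraNneq iQ; rewrite /project map_mxB map_mxM => /eqP.
by rewrite subr_eq0 map_row map_mx1 => /eqP->; exact: submxMl.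
Qed.

Lemma orth_partner j (V W : 'M_(j, m)) (x : 'rV_m) : unramified_part V W ->
  gram S x (frame V W) = 0 -> redmx x != 0 ->
  exists y : 'rV_m, gram S y (frame V W) = 0 /\ red (pairing S x y) != 0.
Proof.
move=> VW xQ x0.
have redS : redmx S \in unitmx by rewrite red_unitmx; have [] := JS.
have /rV0Pn[l xS] : redmx (x *m S) != 0.
  apply: contraNneq x0; rewrite map_mxM => /(canRL (mulmxK redS)).
  by rewrite mul0mx => ->.
exists (project V W (delta_mx 0 l)); split; first exact: project_orth.
by rewrite pairing_project // /pairing /gram trmx_delta -colE !mxE in xS *.
Qed.

(** On the complement [psi(pi x, x)] is even.  By polarization its half is
additive modulo 2 up to [psi(pi x, y)], which is [psi(x, y)] modulo 2; since the
latter is odd for some [x] and [y], the half is odd at [x], [y] or [x + y]. *)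
Lemma orth_odd_norm j (V W : 'M_(j, m)) : unramified_part V W ->
  (r + r + (j + j) < m)%N -> exists (v : 'rV_m) u,
  [/\ gram S v (frame V W) = 0, pairing S (v *m J) v = 2%:R * u & red u != 0].
Proof.
move=> VW lt_m; have [x [xQ x0]] := orth_primitive VW lt_m.
have [y [yQ xy]] := orth_partner VW xQ x0.
have [w wE] := orth_halvable VW xQ.
have halve (z : 'rV_m) : gram S z (frame V W) = 0 ->
    exists u, pairing S (z *m J) z = 2%:R * u.
  move=> zQ; have [t tE] := orth_halvable VW zQ; exists (pairing S t z).
  by rewrite -pairingZl -tE pairingDl (pairing_alt JS) add0r.
have [a aE] := halve x xQ; have [b bE] := halve y yQ.
have [a0|a1] := eqVneq (red a) 0; last by exists x, a.
have [b0|b1] := eqVneq (red b) 0; last by exists y, b.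
exists (x + y), (a + b + pairing S (x *m J) y); split.
- by rewrite gramDl xQ yQ addr0.
- rewrite !mulmxDl !pairingDl !pairingDr aE bE (pairing_adjC JS y x); ring.
have -> : pairing S (x *m J) y = 2%:R * pairing S w y - pairing S x y.
  by rewrite -pairingZl -wE pairingDl addrC addKr.
by rewrite !rmorphD rmorphM rmorphN /= a0 b0 red2 mul0r !add0r oppr_eq0.
Qed.

(** Scaling a vector of the complement with [psi(pi x, x) = 2 u] by an element of
norm [u^-1] brings this value to 2. *)
Lemma unramified_part_extend j (V W : 'M_(j, m)) : unramified_part V W ->
  (r + r + (j + j) < m)%N -> exists V' W' : 'M_(1 + j, m), unramified_part V' W'.
Proof.
move=> VW lt_m; have [x [u [xQ xx u1]]] := orth_odd_norm VW lt_m.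
have [|a [b abE]] := @unit_norm _ p_mod8 u^-1; first by rewrite -unit_Z2 unitrV.
pose v := a *: x + b *: (x *m J).
have vQ : gram S v (frame V W) = 0.
  by rewrite gramDl !gramZl xQ orth_J // !scaler0 addr0.
have vv : pairing S (v *m J) v = 2%:R.
  have p0 z : pairing S z 0 = 0 by rewrite -(scale0r z) pairingZr mul0r.
  have := norm_translate JS 0 x a b; rewrite add0r -/v => ->.
  by rewrite mul0mx !p0 !mulr0 subr0 !add0r -abE xx mulrCA mulVr ?mulr1.
have [w wE] := orth_halvable VW vQ; have vJQ := orth_J VW vQ.
have [VW2 VV VJV VE VJE] := VW.
exists (col_mx v V), (col_mx w W).
have split_frame (z : 'rV_m) : gram S z (frame V W) = 0 ->
    gram S z E = 0 /\ gram S z V = 0.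
  rewrite /gram /frame !tr_col_mx !mul_mx_row => /eqP; rewrite !row_mx_eq0.
  by move=> /andP[/andP[/eqP-> _] /andP[/eqP-> _]].
have [vE vV] := split_frame _ vQ; have [vJE vJV] := split_frame _ vJQ.
have Vv : gram S V v = 0 by rewrite gramC vV trmx0 oppr0.
have VJv : gram S (V *m J) v = 0 by rewrite (gram_adj JS) gramC vJV trmx0 !oppr0.
have vJv : gram S (v *m J) v = 2%:R%:M by rewrite [LHS]mx11_scalar -vv.
have vv0 : gram S v v = 0.
  by rewrite [LHS]mx11_scalar -[_ 0 0]/(pairing S v v) (pairing_alt JS) raddf0.
split.
- by rewrite mul_col_mx add_col_mx wE VW2 scale_col_mx.
- by rewrite gram_col_mx vv0 vV Vv VV block_mx0.
- by rewrite mul_col_mx gram_col_mx vJv vJV VJv VJV -scalar_mx_block.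
- by rewrite gram_col_mxl vE VE col_mx0.
- by rewrite mul_col_mx gram_col_mxl vJE VJE col_mx0.
Qed.

Lemma unramified_part_exists s : r + r + (s + s) = m ->
  exists V W : 'M_(s, m), unramified_part V W.
Proof.
move=> sm; suff exists_le j : (j <= s)%N -> exists V W : 'M_(j, m), unramified_part V W.
  exact: exists_le.
elim: j => [|j IHj] lt_js.
  by exists 0, 0; split; apply/matrixP => -[].
have [V [W VW]] := IHj (ltnW lt_js).
by apply: (unramified_part_extend VW); lia.
Qed.

End Complement.

(** The reduction [A0] is only determined up to congruence by the module, so the
basis is adapted to an arbitrary [A] in its class. *)
Lemma normal_form p m (J S : 'M[Z2]_m) : p = 3 %[mod 8] -> skew_pair p J S ->
  exists r (A0 : 'M['F_2]_r), [/\ A0 \in symGL r, (r + r <= m)%N &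
    forall (A : 'M_r) s, A \in symGL r -> congruent A0 A ->
      r + r + (s + s) = m ->
    exists Q : 'M_(_, m), Q *m J = stdJ p r s *m Q /\ gram S Q Q = stdS s A].
Proof.
move=> p_mod8 JS; pose B := redmx ((1%:M + J) *m S).
have Bsym : B^T = B.
  have [_ ST SJ _] := JS.
  rewrite /B map_trmx mulmxDl mul1mx linearD /= trmx_mul ST mulNmx -SJ.
  by rewrite !map_mxD map_mxN oppmx_F2.
have [F Fu] := symmetric_minor Bsym; set A0 := F *m B *m F^T in Fu.
have lift_A (P : 'M_(\rank B)) (A := P^T *m A0 *m P)
    (e := fun i => row i (map_mx lift2 (P^T *m F))) : lifts_gram J S A e.
  move=> i j; set G := map_mx lift2 (P^T *m F).
  rewrite -pairingDl -[X in pairing S (X + _)]row_mul addrC -linearD -gram_row.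
  rewrite /gram; have -> : G + G *m J = G *m (1%:M + J) by rewrite mulmxDr mulmx1.
  have -> : A = redmx (G *m (1%:M + J) *m S *m G^T).
    rewrite -(mulmxA G) map_mxM map_mxM -/B -map_trmx lift2mxK trmx_mul trmxK.
    by rewrite /A /A0 !mulmxA.
  by rewrite [RHS]mxE.
exists (\rank B), A0.
have A0sym : A0^T = A0 by rewrite /A0 !trmx_mul trmxK Bsym mulmxA.
split; first by rewrite inE Fu A0sym eqxx.
  have := lift_A 1%:M; rewrite trmx1 mul1mx mulmx1 => eA.
  exact: gram_unit_size (gram_unit p_mod8 JS Fu eA).
move=> A s A_symGL /existsP[P /andP[_ /eqP AP]] sm.
have [Au As] : A \in unitmx /\ A^T = A by move: A_symGL; rewrite inE => /andP[? /eqP].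
have := lift_A P; rewrite -AP => /(exact_lift p_mod8 JS Au As)[E [EE EJE]].
have [V [W VW]] := unramified_part_exists p_mod8 JS A_symGL EE EJE (erefl _) sm.
exists (frame J E V W); split; first exact: frame_J VW.
exact: (frame_gram JS A_symGL EE EJE VW).
Qed.

(** * The modules attached to pairs of matrices *)

Section OrderR.
Variable p : nat.
Implicit Types a b : ordR p.

Lemma ordR_poly a : a = (a`_0)%:P + a`_1 *: 'X :> {poly Z2}.
Proof.
apply/polyP => i; rewrite coefD coefC coefZ coefX.
case: i => [|[|i]]; rewrite /= ?mulr0 ?mulr1 ?addr0 ?add0r //.
rewrite nth_default // (leq_trans (size_npoly a)) //.
by rewrite mk_monic_X2p size_X2p.
Qed.

Lemma qX_poly : ('qX : ordR p) = 'X :> {poly Z2}.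
Proof. by rewrite qpolyXE ?size_X2p ?X2p_monic. Qed.

Lemma coef_ordR (c d : Z2) :
  (c *: 1 + d *: 'qX : ordR p) = c%:P + d *: 'X :> {poly Z2}.
Proof.
rewrite -qX_poly; transitivity (c *: (1 : {poly Z2}) + d *: polyn ('qX : ordR p)) => //.
by rewrite alg_polyC.
Qed.

Lemma ordR_eta a : a = a`_0 *: 1 + a`_1 *: 'qX.
Proof. by apply: val_inj; rewrite [RHS]coef_ordR /= -ordR_poly. Qed.

Lemma coef_lin (c d : Z2) (z := c *: 1 + d *: 'qX : ordR p) :
  (z`_0 = c) * (z`_1 = d).
Proof.
by rewrite /z coef_ordR !coefD !coefC !coefZ !coefX /= mulr0 mulr1 addr0 add0r.
Qed.

Lemma ordR_mul a b :
  a * b = (a`_0 * b`_0 - p%:R * (a`_1 * b`_1)) *: 1 + (a`_0 * b`_1 + a`_1 * b`_0) *: 'qX.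
Proof.
rewrite {1}(ordR_eta a) {1}(ordR_eta b).
rewrite mulrDl !mulrDr -!scalerAl -!scalerAr !mul1r mulr1 -expr2 qX2.
have pE c : c *: (- p%:R) = - ((p%:R * c) *: 1) :> ordR p.
  by rewrite scalerN -[p%:R in LHS]scaler_nat scalerA (mulrC c).
rewrite !scalerA pE !scalerDl scaleNr (addrC ((_ * _) *: 'qX) (- _)).
by rewrite addrACA ?(mulrC b`_0).
Qed.

Lemma bar_lin a : bar a = a`_0 *: 1 + (- a`_1) *: 'qX.
Proof.
rewrite /bar; have -> : (a : {poly Z2}) \Po - 'X = a`_0 *: 1 + (- a`_1) *: 'X.
  rewrite {1}ordR_poly comp_polyD comp_polyC comp_polyZ comp_polyX.
  by rewrite alg_polyC scalerN scaleNr.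
by rewrite in_qpolyD !in_qpolyZ in_qpoly1.
Qed.

End OrderR.

Section MatrixModule.
Variables (p m : nat) (J : 'M[Z2]_m) (JJ : J *m J = (- p%:R)%:M).

(** The module of row vectors on which [pi] acts by [J]; the proof is an argument
so that the module structure can be inferred from the type. *)
Definition mxmod of J *m J = (- p%:R)%:M : Type := 'rV[Z2]_m.
Local Notation M := (mxmod JJ).

HB.instance Definition _ := GRing.Zmodule.on M.

Definition mxmod_scale (a : ordR p) (x : M) : M :=
  a`_0 *: (x : 'rV_m) + a`_1 *: ((x : 'rV_m) *m J).

Lemma mxmod_scaleA a b x : mxmod_scale a (mxmod_scale b x) = mxmod_scale (a * b) x.
Proof.
rewrite /mxmod_scale ordR_mul !coef_lin mulmxDl -!scalemxAl -(mulmxA x) JJ mul_mx_scalar.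
by apply/rowP => i; rewrite !mxE; ring.
Qed.

Lemma mxmod_scale1 : left_id 1 mxmod_scale.
Proof. by move=> x; rewrite /mxmod_scale !coefC /= scale1r scale0r addr0. Qed.

Lemma mxmod_scaleDr : right_distributive mxmod_scale +%R.
Proof.
by move=> a x y; rewrite /mxmod_scale mulmxDl !scalerDr addrACA.
Qed.

Lemma mxmod_scaleDl x : {morph mxmod_scale^~ x : a b / a + b}.
Proof.
by move=> a b; rewrite /mxmod_scale !coefD !scalerDl addrACA.
Qed.

HB.instance Definition _ := GRing.Zmodule_isLmodule.Build (ordR p) M
  mxmod_scaleA mxmod_scale1 mxmod_scaleDr mxmod_scaleDl.

Lemma mxmod_scaleE (a : ordR p) (x : M) :
  a *: x = (a`_0 *: (x : 'rV_m) + a`_1 *: ((x : 'rV_m) *m J) : 'rV_m).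
Proof. by []. Qed.

Lemma mxmod_qX (x : M) : 'qX *: x = ((x : 'rV_m) *m J : 'rV_m).
Proof.
have -> : 'qX = 0 *: 1 + 1 *: 'qX :> ordR p by rewrite scale0r add0r scale1r.
by rewrite mxmod_scaleE !coef_lin scale0r add0r scale1r.
Qed.

Lemma res_scaleE (c : Z2) (x : res2 M) : c *: x = (c *: (x : 'rV_m) : 'rV_m).
Proof.
rewrite -[LHS]/((c%:A : ordR p) *: (x : M)) mxmod_scaleE.
have -> : c%:A = c *: 1 + 0 *: 'qX :> ordR p by rewrite scale0r addr0.
by rewrite !coef_lin scale0r addr0.
Qed.

Lemma mxmod_free : free_of_rank (res2 M) m.
Proof.
exists (fun x : res2 M => (x : 'rV_m)); split; last by exists id.
by move=> c x y; rewrite -res_scaleE.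
Qed.

Lemma mxmod_fin_gen : fin_gen M.
Proof.
exists m, (fun i => (delta_mx 0 i : 'rV_m) : M) => x.
exists (fun i => ((x : 'rV_m) 0 i)%:A).
rewrite [LHS](row_sum_delta (x : 'rV_m)); apply: eq_bigr => i _.
exact: (esym (res_scaleE ((x : 'rV_m) 0 i) (delta_mx 0 i : 'rV_m))).
Qed.

Variables (S : 'M[Z2]_m).

Definition mxpsi (x y : res2 M) : Z2 := pairing S (x : 'rV_m) (y : 'rV_m).

Lemma mxpsi_bilinear : bilinear_for
  (GRing.mul : GRing.Scale.law Z2 Z2) (GRing.mul : GRing.Scale.law Z2 Z2) mxpsi.
Proof.
split=> [y c x x'|x c y y']; rewrite res_scaleE /mxpsi.
  by rewrite pairingDl pairingZl.
by rewrite pairingDr pairingZr.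
Qed.

HB.instance Definition _ :=
  bilinear_isBilinear.Build Z2 (res2 M) (res2 M) Z2 *%R *%R mxpsi mxpsi_bilinear.

End MatrixModule.

Section MatrixSkewHerm.
Variables (p m : nat) (J S : 'M[Z2]_m) (JS : skew_pair p J S).

(** A transparent projection, as it occurs in types. *)
Definition sq_J : J *m J = (- p%:R)%:M := let: And4 h _ _ _ := JS in h.

Local Notation M := (mxmod sq_J).

(** A vector is determined by its pairings with the basis vectors, because [S] is
invertible. *)
Lemma pairing_inj (x z : 'rV[Z2]_m) : pairing S x =1 pairing S z -> x = z.
Proof.
move=> xz; have [_ _ _ Su] := JS; apply: (can_inj (mulmxK Su)).
apply/rowP => j; have := xz (delta_mx 0 j).
by rewrite /pairing /gram trmx_delta -!colE !mxE.
Qed.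

Lemma mxpsi_alternating (x : res2 M) : mxpsi S x x = 0.
Proof. exact: (pairing_alt JS). Qed.

Lemma mxpsi_nondegenerate (x : res2 M) : (forall y : res2 M, mxpsi S x y = 0) -> x = 0.
Proof.
move=> x0; apply: (@pairing_inj x 0) => y.
by rewrite -(scale0r 0) pairingZl mul0r; apply: x0.
Qed.

Lemma mxpsi_adjoint (a : ordR p) (x y : M) :
  mxpsi S (a *: x : M) y = mxpsi S x (bar a *: y : M).
Proof.
rewrite bar_lin !mxmod_scaleE !coef_lin /mxpsi !pairingDl !pairingDr.
by rewrite !pairingZl !pairingZr (pairing_adj JS) mulrN mulNr.
Qed.

Definition matrix_sh : skewHerm p :=
  @SkewHerm p M (mxmod_fin_gen sq_J) (ex_intro _ m (mxmod_free sq_J))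
    (mxpsi S : {biscalar (res2 M)})
    mxpsi_alternating mxpsi_nondegenerate mxpsi_adjoint.

Lemma matrix_sh_rank : has_rank matrix_sh m.
Proof. exact: mxmod_free. Qed.

Lemma matrix_sh_self_dual : self_dual matrix_sh.
Proof.
move=> f; have [_ _ _ Su] := JS.
pose c : 'rV[Z2]_m := \row_j f (delta_mx 0 j : 'rV_m).
have fE (y : 'rV[Z2]_m) : f y = (c *m y^T) 0 0.
  rewrite {1}(row_sum_delta y).
  rewrite (_ : \sum_j _ = \sum_j y 0 j *: ((delta_mx 0 j : 'rV_m) : res2 M)); last first.
    by apply: eq_bigr => j _; rewrite res_scaleE.
  rewrite linear_sum mxE; apply: eq_bigr => j _.
  by rewrite linearZ_LR !mxE mulrC.
exists (c *m invmx S : 'rV_m); split.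
  by move=> y; rewrite fE /= /mxpsi /pairing /gram mulmxKV.
move=> x xE; apply/esym/pairing_inj => y.
by rewrite [LHS]xE fE [RHS]/pairing /gram mulmxKV.
Qed.

End MatrixSkewHerm.

Section Coordinates.
Variables (p m : nat) (M : skewHerm p).
Hypotheses (M_self_dual : self_dual M) (M_rank : has_rank M m).

(** Self-duality makes the Gram matrix invertible: its inverse consists of the
vectors representing the coordinate functions. *)
Lemma has_coordinates : exists (J S : 'M[Z2]_m) (JS : skew_pair p J S),
  sh_iso M (matrix_sh JS).
Proof.
have [f [f_lin [g fK gK]]] := M_rank.
pose F : {linear res2 M -> 'rV[Z2]_m} :=
  HB.pack f (GRing.isLinear.Build Z2 (res2 M) 'rV[Z2]_m *:%R f f_lin).
have g_lin : linear g.
  by move=> c x y; apply: (can_inj fK); rewrite gK f_lin !gK.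
pose G : {linear 'rV[Z2]_m -> res2 M} :=
  HB.pack g (GRing.isLinear.Build Z2 'rV[Z2]_m (res2 M) *:%R g g_lin).
have resE (c : Z2) (x : res2 M) : c *: x = ((c%:A : ordR p) *: (x : M) : M) by [].
pose phi (v : 'rV[Z2]_m) := f ('qX *: (g v : M) : M).
have phi_lin : linear phi.
  move=> c x y; rewrite /phi g_lin -f_lin !resE scalerDr !scalerA.
  by rewrite (mulrC 'qX).
pose Phi : {linear 'rV[Z2]_m -> 'rV[Z2]_m} :=
  HB.pack phi (GRing.isLinear.Build Z2 'rV[Z2]_m 'rV[Z2]_m *:%R phi phi_lin).
pose J := lin1_mx Phi.
have fX (x : M) : f ('qX *: x : M) = f x *m J.
  by rewrite (mul_rV_lin1 Phi) /= /phi fK.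
pose S : 'M[Z2]_m := \matrix_(i, j) psi M (g (delta_mx 0 i)) (g (delta_mx 0 j)).
have psiE x y : psi M x y = pairing S (f x) (f y).
  have gE v : g v = \sum_i v 0 i *: g (delta_mx 0 i).
    rewrite {1}(row_sum_delta v) -[g _]/(G _) linear_sum.
    by apply: eq_bigr => i _; rewrite linearZ.
  rewrite -{1}(fK x) -{1}(fK y) gE linear_sumlz /pairing /gram -mulmxA mxE.
  apply: eq_bigr => i _; rewrite linearZl_LR (gE (f y)) linear_sumr mxE; congr (_ * _).
  by apply: eq_bigr => j _; rewrite linearZr_LR !mxE mulrC.
have psi_anti x y : psi M x y = - psi M y x.
  apply/eqP; rewrite -subr_eq0 opprK; apply/eqP.
  have := psi_alternating (x + y : res2 M).
  rewrite linearDl !linearDr !psi_alternating add0r addr0 => <-.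
  by [].
have psi_X x y : psi M ('qX *: x : M) y = - psi M x ('qX *: y : M).
  rewrite psi_adjoint bar_qX scaleNr.
  exact: linearNr.
have XX (x : M) : 'qX *: ('qX *: x) = ((- p%:R)%:A : ordR p) *: x.
  rewrite scalerA -expr2 qX2; congr (_ *: _).
  by rewrite scaleNr scaler_nat.
have f_surj v : exists x, v = f x by exists (g v); rewrite gK.
have mx_ext (X Y : 'M[Z2]_m) : (forall v w, pairing X v w = pairing Y v w) -> X = Y.
  move=> XY; apply/matrixP => i j; have := XY (delta_mx 0 i) (delta_mx 0 j).
  by rewrite /pairing /gram -!rowE trmx_delta -!colE !mxE.
have JS : skew_pair p J S.
  split.
  - apply/row_matrixP => i; rewrite row_mul !rowE; have [x ->] := f_surj (delta_mx 0 i).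
    by rewrite -!fX XX -resE -[f _]/(F _) linearZ mul_mx_scalar.
  - apply/matrixP => i j; rewrite !mxE psi_anti //.
  - apply: mx_ext => v w; have [x ->] := f_surj v; have [y ->] := f_surj w.
    have := psi_X x y; rewrite !psiE !fX /pairing /gram trmx_mul.
    by rewrite mulmxN mulNmx !mulmxA => ->; rewrite [RHS]mxE.
  pose coord j (y : res2 M) : Z2 := f y 0 j.
  have coord_lin j : scalar (coord j).
    by move=> c x y; rewrite /coord f_lin !mxE.
  pose Coord j : {scalar (res2 M)} :=
    HB.pack (coord j) (GRing.isLinear.Build Z2 (res2 M) Z2 *%R (coord j) (coord_lin j)).
  have /choice[x xE] j : exists x, psi M x =1 coord j.
    by have [x [xE _]] := M_self_dual (Coord j); exists x.
  apply: (proj2 (mulmx1_unit (A := \matrix_j f (x j)) _)).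
  apply/matrixP => j k; rewrite [RHS]mxE.
  have := xE j (g (delta_mx 0 k)); rewrite psiE /coord gK mxE eqxx eq_sym /= => <-.
  rewrite -(rowK (fun j => f (x j)) j).
  by rewrite /pairing /gram trmx_delta -row_mul -colE !mxE.
exists J, S, JS, (f : M -> mxmod (sq_J JS)); split.
- move=> a x y; rewrite mxmod_scaleE -fX.
  have -> : a *: x + y =
      a`_0 *: (x : res2 M) + (a`_1 *: ('qX *: x : res2 M) + (y : res2 M)).
    rewrite {1}(ordR_eta a) scalerDl -addrA !resE; congr (_ + (_ + _)).
    by rewrite scalerA mulr_algl.
  by rewrite !f_lin addrA.
- by exists g.
- by move=> x y; rewrite psiE.
Qed.
End Coordinates.

Lemma sh_iso_sym p (M N : skewHerm p) : sh_iso M N -> sh_iso N M.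
Proof.
move=> [f [f_lin [g fK gK] f_psi]]; exists g; split; last 2 first.
- by exists f.
- by move=> x y; rewrite -f_psi !gK.
by move=> a x y; apply: (can_inj fK); rewrite f_lin !gK.
Qed.

Lemma sh_iso_trans p (L M N : skewHerm p) : sh_iso L M -> sh_iso M N -> sh_iso L N.
Proof.
move=> [f [f_lin f_bij f_psi]] [g [g_lin g_bij g_psi]]; exists (g \o f); split.
- by move=> a x y /=; rewrite f_lin g_lin.
- exact: bij_comp.
- by move=> x y /=; rewrite g_psi f_psi.
Qed.

(** The two sizes are equal, but not by computation, so they are kept apart. *)
Lemma matrix_sh_iso p m m' (J S : 'M[Z2]_m) (JS : skew_pair p J S)
    (J' S' : 'M[Z2]_m') (JS' : skew_pair p J' S') (P : 'M_(m, m')) :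
  m = m' -> J *m P = P *m J' -> gram S' P P = S -> sh_iso (matrix_sh JS) (matrix_sh JS').
Proof.
move=> mm'; case: m' / mm' in J' S' JS' P *; move=> JP SP.
have Pu : P \in unitmx.
  have [_ _ _ Su] := JS; move: Su; rewrite -SP /gram !unitmx_mul.
  by case/andP => /andP[].
exists ((fun x : 'rV[Z2]_m => x *m P) : mxmod (sq_J JS) -> mxmod (sq_J JS')); split.
- move=> a x y; rewrite !mxmod_scaleE !mulmxDl -!scalemxAl.
  by rewrite -!mulmxA JP.
- by exists (fun x : 'rV[Z2]_m => x *m invmx P); [exact: mulmxK | exact: mulmxKV].
- move=> x y; rewrite /= /mxpsi /pairing -SP.
  by rewrite gramMl gramMr /gram !mulmxA.
Qed.

Lemma matrix_sh_iso_mx p m m' (J S : 'M[Z2]_m) (JS : skew_pair p J S)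
    (J' S' : 'M[Z2]_m') (JS' : skew_pair p J' S') :
  sh_iso (matrix_sh JS) (matrix_sh JS') ->
  exists P : 'M_(m, m'), J *m P = P *m J' /\ gram S' P P = S.
Proof.
move=> [f [f_lin _ f_psi]].
pose h (x : 'rV[Z2]_m) : 'rV[Z2]_m' := f x.
have h_lin : linear h.
  move=> c x y; rewrite /h.
  have := f_lin (c *: 1 + 0 *: 'qX) x y.
  by rewrite !mxmod_scaleE !coef_lin !scale0r !addr0.
pose H : {linear 'rV[Z2]_m -> 'rV[Z2]_m'} :=
  HB.pack h (GRing.isLinear.Build Z2 'rV[Z2]_m 'rV[Z2]_m' *:%R h h_lin).
have hE x : h x = x *m lin1_mx H by rewrite (mul_rV_lin1 H).
exists (lin1_mx H); split.
  apply/row_matrixP => i; rewrite !rowE !mulmxA -!hE.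
  have fX := scalable_linear f_lin 'qX (delta_mx 0 i : mxmod (sq_J JS)).
  rewrite mxmod_qX in fX.
  exact: etrans fX (mxmod_qX (f (delta_mx 0 i : mxmod (sq_J JS)) : mxmod (sq_J JS'))).
apply/matrixP => i j; rewrite gram_row !rowE -!hE -[LHS]/(psi (matrix_sh JS') _ _).
by rewrite /h f_psi /= /mxpsi /pairing /gram -rowE trmx_delta -colE !mxE.
Qed.

(** * Invariants of the standard modules and the count *)

Lemma congruentP r (A B : 'M['F_2]_r) :
  reflect (exists2 P, P \in unitmx & B = P^T *m A *m P) (congruent A B).
Proof.
apply: (iffP existsP) => [[P /andP[Pu /eqP]]|[P Pu ->]]; first by exists P.
by exists P; rewrite Pu eqxx.
Qed.

Lemma congruent_refl r : reflexive (@congruent r).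
Proof.
move=> A; apply/congruentP; exists 1%:M; first exact: unitmx1.
by rewrite trmx1 mul1mx mulmx1.
Qed.

Lemma congruent_sym r (A B : 'M_r) : congruent A B -> congruent B A.
Proof.
case/congruentP => P Pu ->; apply/congruentP.
exists (invmx P); first by rewrite unitmx_inv.
by rewrite trmx_inv !mulmxA mulVmx ?unitmx_tr // mul1mx mulmxK.
Qed.

Lemma congruent_trans r : transitive (@congruent r).
Proof.
move=> B A C /congruentP[P Pu ->] /congruentP[Q Qu ->]; apply/congruentP.
by exists (P *m Q); rewrite ?unitmx_mul ?Pu // trmx_mul !mulmxA.
Qed.

Lemma congruent_equiv r : equivalence_rel (@congruent r).
Proof.
move=> A B C; split; first exact: congruent_refl.
move=> AB; apply/idP/idP; first exact/congruent_trans/congruent_sym.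
exact: congruent_trans.
Qed.

(** For [r = 0] the single class is that of the empty matrix, in accordance with
[m_0 = 1]. *)
Lemma class_representatives r : exists f : 'I_(num_sym_classes r) -> 'M['F_2]_r,
  [/\ forall i, f i \in symGL r,
      forall i j, congruent (f i) (f j) -> i = j
    & forall A, A \in symGL r -> exists i, congruent A (f i)].
Proof.
case: r => [|r].
  exists (fun=> 1%:M); split=> [i|i j _|A _]; last 1 first.
  - by exists ord0; rewrite [A]flatmx0 [X in congruent _ X]flatmx0 congruent_refl.
  - by rewrite inE unitmx1 trmx1 eqxx.
  - by rewrite [i]ord1 [j]ord1.
rewrite /num_sym_classes; set D := symGL r.+1.
have eqD : {in D & &, equivalence_rel (@congruent r.+1)}.
  by move=> A B C _ _ _; apply: congruent_equiv.
set P := equivalence_partition _ _.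
have partP : partition P D := equivalence_partitionP eqD.
have f_ex (i : 'I_#|P|) : exists A, A \in enum_val i.
  by apply/set0Pn; apply: contraTneq (enum_valP i) => ->; case/and3P: partP.
have /choice[f fP] := f_ex.
have fD i : f i \in D.
  rewrite -(cover_partition partP); apply/bigcupP.
  by exists (enum_val i); rewrite ?enum_valP.
have trivP : trivIset P by case/and3P: partP.
have pbf i : pblock P (f i) = enum_val i.
  by apply: def_pblock => //; apply: enum_valP.
exists f; split=> // [i j ij|A AD].
  apply: enum_val_inj; rewrite -!pbf; apply/eqP.
  rewrite eq_pblock ?(cover_partition partP) //.
  by rewrite pblock_equivalence_partition.
have AP : pblock P A \in P by rewrite pblock_mem // (cover_partition partP).
exists (enum_rank_in AP (pblock P A)).
rewrite -(pblock_equivalence_partition eqD) //.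
by have := fP (enum_rank_in AP (pblock P A)); rewrite enum_rankK_in.
Qed.

Definition representative r := projT1 (cid (class_representatives r)).

Section Models.
Variables (p : nat) (p_mod8 : p = 3 %[mod 8]).

Definition model r s (A : 'M_r) (AS : A \in symGL r) : skewHerm p :=
  matrix_sh (std_skew_pair s (p_odd p_mod8) AS).

(** An isomorphism carries one reduced form to the other; pulling back along a
section of [rowsum] expresses [A] through [A'], whatever the two sizes are. *)
Lemma model_reduction r s r' s' (A : 'M_r) (AS : A \in symGL r)
    (A' : 'M_r') (AS' : A' \in symGL r') :
  sh_iso (model s AS) (model s' AS') ->
  exists Y, A = Y^T *m A' *m Y.
Proof.
move=> /matrix_sh_iso_mx[P [JP SP]]; have [X GX] := rowsum_right_inverse r s.
pose B := redmx ((1%:M + stdJ p r s) *m stdS s A).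
pose B' := redmx ((1%:M + stdJ p r' s') *m stdS s' A').
have BB' : B = redmx P *m B' *m (redmx P)^T.
  rewrite /B /B' map_trmx -!map_mxM -{1}SP /gram !mulmxA; congr (redmx (_ *m _ *m _)).
  by rewrite mulmxDl mulmxDr JP mul1mx mulmx1.
exists (rowsum r' s' *m (redmx P)^T *m X).
have -> : A = X^T *m B *m X.
  rewrite /B (stdS_reduction _ _ p_mod8) -!mulmxA GX mulmx1 !mulmxA.
  by rewrite -trmx_mul GX trmx1 mul1mx.
by rewrite BB' /B' (stdS_reduction _ _ p_mod8) !trmx_mul trmxK !mulmxA.
Qed.

Lemma symGL_unit r (A : 'M_r) : A \in symGL r -> A \in unitmx.
Proof. by rewrite inE => /andP[]. Qed.

(** [A] and [A'] are invertible, and each is obtained from the other by a change of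
variables. *)
Lemma model_size r s r' s' (A : 'M_r) (AS : A \in symGL r)
    (A' : 'M_r') (AS' : A' \in symGL r') :
  sh_iso (model s AS) (model s' AS') -> r = r'.
Proof.
have le_r r1 s1 r2 s2 (A1 : 'M_r1) (AS1 : A1 \in symGL r1)
    (A2 : 'M_r2) (AS2 : A2 \in symGL r2) :
  sh_iso (model s1 AS1) (model s2 AS2) -> (r1 <= r2)%N.
  case/model_reduction => Y A1E; rewrite -(mxrank_unit (symGL_unit AS1)) A1E.
  rewrite -mulmxA (leq_trans (mxrankM_maxr _ _)) //.
  by rewrite (leq_trans (mxrankM_maxl _ _)) // rank_leq_row.
move=> iso; apply/eqP; rewrite eqn_leq (le_r _ _ _ _ _ _ _ _ iso).
exact: (le_r _ _ _ _ _ _ _ _ (sh_iso_sym iso)).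
Qed.

Lemma model_congruent r s s' (A : 'M_r) (AS : A \in symGL r)
    (A' : 'M_r) (AS' : A' \in symGL r) :
  sh_iso (model s AS) (model s' AS') -> congruent A' A.
Proof.
case/model_reduction => Y AE; apply/congruentP; exists Y => //.
by move: (symGL_unit AS); rewrite AE unitmx_mul => /andP[].
Qed.

Lemma model_exhausts n (M : skewHerm p) : self_dual M -> has_rank M (2 * n) ->
  exists r (A0 : 'M['F_2]_r), [/\ A0 \in symGL r, (r <= n)%N &
    forall (A : 'M_r) (AS : A \in symGL r), congruent A0 A ->
      sh_iso M (model (n - r) AS)].
Proof.
move=> M_dual M_rank; have [J [S [JS MJS]]] := has_coordinates M_dual M_rank.
have [r [A0 [AS0 le_r nf]]] := normal_form p_mod8 JS.
have rn : (r <= n)%N by lia.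
exists r, A0; split=> // A AS A0A; apply: sh_iso_trans MJS _; apply: sh_iso_sym.
have [|Q [QJ QS]] := nf A (n - r)%N AS A0A; first by lia.
by apply: (matrix_sh_iso _ _ (P := Q)) => //; lia.
Qed.

End Models.

Local Open Scope nat_scope.

Theorem theorem1p2 (p n : nat) (p_prime : prime p) (p_mod8 : p = 3 %[mod 8])
    (n_ge1 : 1 <= n) :
  num_iso_classes (fun M : skewHerm p => self_dual M /\ has_rank M (2 * n))
    (\sum_(0 <= r < n.+1) num_sym_classes r).
Proof.
rewrite big_mkord -tagnat.card.
pose T := {i : 'I_n.+1 & 'I_(num_sym_classes i)}.
have rep_sym r i : representative i \in symGL r.
  by rewrite /representative; case: cid => f /= [].
pose F (t : T) := model p_mod8 (n - tag t) (rep_sym (tag t) (tagged t)).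
exists (fun i => F (enum_val i)); split.
- move=> i; split; first exact: matrix_sh_self_dual.
  have -> : (2 * n = tag (enum_val i) + tag (enum_val i) +
      (n - tag (enum_val i) + (n - tag (enum_val i))))%N.
    by have := ltn_ord (tag (enum_val i)); lia.
  exact: matrix_sh_rank.
- move=> i j iso; apply: enum_val_inj; move: iso.
  move: (enum_val i) (enum_val j) => [r a] [r' a'] iso.
  have rr' : r = r' by apply: val_inj; apply: model_size iso.
  case: r' / rr' in a' iso *; congr (Tagged _ _).
  have := model_congruent iso; rewrite /= /representative.
  by case: cid => f /= [_ f_inj _] /f_inj.
move=> M [M_dual M_rank]; have [r [A0 [AS0 rn MA]]] := model_exhausts p_mod8 M_dual M_rank.
have [i A0i] : exists i, congruent A0 (representative i).
  by rewrite /representative; case: cid => f /= [_ _]; apply.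
pose r' : 'I_n.+1 := Ordinal (rn : (r < n.+1)%N).
pose t : T := Tagged (fun r : 'I_n.+1 => 'I_(num_sym_classes r))
  (i : 'I_(num_sym_classes r')).
exists (enum_rank t); rewrite enum_rankK.
exact: MA.
Qed.
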